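(* Let $K\ge 2$ and let $\pi=(p_1,\dots,p_K)$ be a probability vector with $p_1>p_2\ge p_3\ge\cdots\ge p_K>0$ and $\sum_{k=1}^K p_k=1$. Answers $a^{(1)},a^{(2)},\dots$ are drawn i.i.d. from $\pi$ over $K$ unlabeled answers $a_1,\dots,a_K$. For $L\in\{2,\dots,K\}$ and $\delta\in(0,1/2)$, let $n^{\star,L}=n^{\star,L}(\delta):=\inf\{n\ge 1:\ \mathbb{P}(H_1\mid \mathcal{C}_n^L)\ge 1-\delta\}$, where $\mathbb{P}(H_1\mid\mathcal{C}_n^L)$ is the $L$-aggregated posterior defined in the context. Then: (i) for $L=2$, $$\lim_{\delta\to 0}\frac{\mathbb{E}[n^{\star,2}]}{\log(1/\delta)}=\frac{1}{\mathrm{D}_{\mathrm{KL}}(p_1\,\|\,p_2)},$$ where $\mathrm{D}_{\mathrm{KL}}(p_1\|p_2)=p_1\log\frac{p_1}{p_2}+(1-p_1)\log\frac{1-p_1}{1-p_2}$ is the KL divergence between $\mathrm{Bern}(p_1)$ and $\mathrm{Bern}(p_2)$; (ii) for every $L\in\{3,4,\dots,K\}$, $$\lim_{\delta\to 0}\frac{\mathbb{E}[n^{\star,L}]}{\log(1/\delta)}=\frac{1}{(p_1-p_2)\log\frac{p_1}{p_2}}.$$ The expectation is with respect to the i.i.d. sampling from $\pi$.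
   Context: Observation model: the labels of the answers are not observed; only which samples are identical. After $n$ samples let $M(n)$ be the number of distinct answers observed and $n_1\ge n_2\ge\cdots\ge n_{M(n)}\ge1$ their occurrence counts (so $\sum_j n_j=n$). For $L\in\{2,\dots,K\}$ set $L(n):=\min\{L-1,M(n)\}$, $v_d:=n_{L(n)}$, $c'_d:=\#\{j\le L(n): n_j=v_d\}$, and $\bar n:=n-\sum_{i=1}^{L(n)}n_i$. The $L$-aggregated state $\mathcal{C}_n^L$ consists of $n$ and the top counts $(n_1,\dots,n_{L(n)})$. For an injective map $\psi:\{1,\dots,L(n)\}\to\{1,\dots,K\}$, let $J_\psi=\{1,\dots,K\}\setminus\psi(\{1,\dots,L(n)\})$ and $$\tilde S_\psi:=\sum_{\mathbf r} w(\mathbf r)\,\frac{\bar n!}{\prod_{j\in J_\psi} r_j!}\prod_{j\in J_\psi}p_j^{r_j},$$ the sum over all $\mathbf r=(r_j)_{j\in J_\psi}$ with $r_j\in\{0,1,\dots,v_d\}$ and $\sum_{j\in J_\psi}r_j=\bar n$, where $w(\mathbf r):=\binom{c'_d+m(\mathbf r)}{c'_d}^{-1}$ and $m(\mathbf r):=\#\{j\in J_\psi: r_j=v_d\}$. The $L$-aggregated posterior is $$\mathbb{P}(H_1\mid\mathcal{C}_n^L):=\frac{\sum_{\psi:\ \psi(1)=1}\big(\prod_{j=1}^{L(n)}p_{\psi(j)}^{n_j}\big)\tilde S_\psi}{\sum_{\psi}\big(\prod_{j=1}^{L(n)}p_{\psi(j)}^{n_j}\big)\tilde S_\psi},$$ with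 sums over injective maps $\psi:\{1,\dots,L(n)\}\to\{1,\dots,K\}$; it is the approximate posterior probability that the most frequently observed answer is the true mode $a_1$ (hypothesis $H_1$). The stopping rule stops at the first $n$ where this exceeds $1-\delta$ and outputs the most frequent observed answer. *)

(* Defs.v *)
From HB Require Import structures.
From mathcomp Require Import all_boot all_order all_algebra.
From mathcomp Require Import all_classical all_reals all_analysis.
Set Implicit Arguments. Unset Strict Implicit. Unset Printing Implicit Defensive.
Import Order.TTheory GRing.Theory Num.Theory.
Import numFieldNormedType.Exports.
Local Open Scope ring_scope.

(* Answers are indexed 0..K-1 (paper: a_1..a_K); the true mode a_1 is index 0.
   p : nat -> R gives p_{i+1} = p i for i < K. *)

(* Sorted (non-increasing) list of the positive occurrence counts n_1 >= ... >= n_M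
   of a sample sequence s (only equalities of samples matter, not labels). *)
Definition sorted_counts (K : nat) (s : seq 'I_K) : seq nat :=
  sort geq [seq c <- [seq count_mem k s | k <- enum 'I_K] | (0 < c)%N].

Section Posterior.
Variables (R : realType) (K L : nat) (p : nat -> R) (ns : seq nat).

Definition Ln : nat := minn L.-1 (size ns).
Definition vd : nat := nth 0%N ns Ln.-1.
Definition cd : nat := count (pred1 vd) (take Ln ns).
Definition nbar : nat := (sumn ns - sumn (take Ln ns))%N.

Definition inJ (psi : {ffun 'I_Ln -> 'I_K}) (j : 'I_K) : bool := j \notin codom psi.

(* admissible r = (r_j)_{j in J_psi}, r_j in {0..v_d}, sum = nbar;
   encoded as a function on all of 'I_K vanishing outside J_psi. *)
Definition admissible (psi : {ffun 'I_Ln -> 'I_K}) (r : {ffun 'I_K -> 'I_vd.+1}) : bool :=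
  [forall j, ~~ inJ psi j ==> (nat_of_ord (r j) == 0%N)] &&
  (\sum_(j | inJ psi j) nat_of_ord (r j) == nbar)%N.

Definition mr (psi : {ffun 'I_Ln -> 'I_K}) (r : {ffun 'I_K -> 'I_vd.+1}) : nat :=
  #|[pred j | inJ psi j && (nat_of_ord (r j) == vd)]|.

Definition wr (psi : {ffun 'I_Ln -> 'I_K}) (r : {ffun 'I_K -> 'I_vd.+1}) : R :=
  ('C(cd + mr psi r, cd))%:R^-1.

Definition Stilde (psi : {ffun 'I_Ln -> 'I_K}) : R :=
  \sum_(r : {ffun 'I_K -> 'I_vd.+1} | admissible psi r)
     wr psi r * ((nbar`!)%:R / \prod_(j | inJ psi j) ((nat_of_ord (r j))`!)%:R)
       * \prod_(j | inJ psi j) p j ^+ r j.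

Definition psi_weight (psi : {ffun 'I_Ln -> 'I_K}) : R :=
  (\prod_(i : 'I_Ln) p (psi i) ^+ nth 0%N ns i) * Stilde psi.

(* L-aggregated posterior P(H_1 | C_n^L); the sums range over injective psi,
   the numerator over those with psi(1) = 1 (index 0 |-> answer 0). *)
Definition agg_posterior : R :=
  (\sum_(psi : {ffun 'I_Ln -> 'I_K} | injectiveb psi &&
          [forall i : 'I_Ln, (nat_of_ord i == 0%N) ==> (nat_of_ord (psi i) == 0%N)])
      psi_weight psi)
  / \sum_(psi : {ffun 'I_Ln -> 'I_K} | injectiveb psi) psi_weight psi.

End Posterior.

Definition posterior_of (R : realType) (K L : nat) (p : nat -> R) (s : seq 'I_K) : R :=
  agg_posterior K L p (sorted_counts s).

Definition seq_prob (R : realType) (K : nat) (p : nat -> R) (s : seq 'I_K) : R :=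
  \prod_(x <- s) p x.

(* P(n^{*,L} > n): the posterior stayed below 1 - delta at every time 1..n. *)
Definition survival (R : realType) (K L : nat) (p : nat -> R) (delta : R) (n : nat) : R :=
  \sum_(s : n.-tuple 'I_K |
          [forall m : 'I_n, posterior_of L p (take m.+1 s) < 1 - delta])
     seq_prob p s.

(* E[n^{*,L}(delta)] = sum_{n >= 0} P(n^{*,L} > n)  (value +oo allowed,
   which covers n^{*,L} = inf(empty) = +oo with positive probability). *)
Definition expected_stop (R : realType) (K L : nat) (p : nat -> R) (delta : R) : \bar R :=
  (\sum_(0 <= n <oo) (survival K L p delta n)%:E)%E.

Definition KL_bern (R : realType) (a b : R) : R :=
  a * ln (a / b) + (1 - a) * ln ((1 - a) / (1 - b)).

(* Main.v *)
(**
Write the posterior as A / (A + B), where A collects the assignments psi with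
psi(1) = 1.  Exchanging two labels is a bijection on pairs (psi, r) which
preserves the multinomial factor and the tie weight, and multiplies the
likelihood by (p_b / p_a)^(x_a - x_b), where x is the vector of counts
allotted to the labels.

For L >= 3 every label other than psi(1) is allotted at most n_2 occurrences,
so exchanging labels gives
  (p_2/p_1)^(n_1 - n_2) A / K <= B <= K (p_2/p_1)^(n_1 - n_2) A.
For L = 2 there is no such bound; instead the truncated multinomial sum
S~_a is the total weight of the words of length nbar in the labels j <> a in
which no label occurs more than n_1 times.  It is at most (1 - p_a)^nbar, and
by a Chernoff bound at least a constant fraction of it for a = 1, 2, so that
B / A is (p_2/p_1)^n_1 ((1 - p_2)/(1 - p_1))^nbar up to constants.

Hence 1 - posterior is exp(- n (D + o(1))) on samples with typical
frequencies, with D the announced rate, and atypical samples have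
exponentially small probability.  The single exchange of labels 1 and 2 also
gives the deterministic bound 1 - posterior >= c^n, which rules out stopping
before a time of order log(1/delta), so the union bound over atypical prefixes
starts at a large index.
*)
Require Import Defs.
From HB Require Import structures.
From mathcomp Require Import all_boot all_order all_algebra.
From mathcomp Require Import all_classical all_reals all_analysis.
From mathcomp Require Import fingroup perm ring lra zify.
Import Order.TTheory GRing.Theory Num.Theory.
Import numFieldNormedType.Exports.
Local Open Scope classical_set_scope.
Local Open Scope ring_scope.

(** * Integration over words of independent letters: moments, Chernoff and multinomial formulas *)

Section IidExpectation.
Context {R : realType} {T : finType}.
Implicit Types (q f : T -> R) (F G : seq T -> R) (A : pred (seq T)) (s : seq T).

(* Integral of [F] over words of length [n] against the product weight [q];
   [q] need not have mass 1. *)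
Fixpoint iid q (n : nat) F : R :=
  if n is m.+1 then \sum_x q x * iid q m (fun s => F (x :: s)) else F [::].

Lemma eq_iid q n F G :
  (forall s, size s = n -> F s = G s) -> iid q n F = iid q n G.
Proof.
elim: n F G => [|n IH] F G FG /=; first exact: FG.
by apply: eq_bigr => x _; congr (_ * _); apply: IH => s sn; apply: FG; rewrite /= sn.
Qed.

(** Bridge from sums over tuples, the form of [survival], to the recursive integral. *)
Lemma sum_tuple_iid q n A :
  \sum_(s : n.-tuple T | A s) \prod_(x <- s) q x = iid q n (fun s => (A s)%:R).
Proof.
elim: n A => [|n IH] A.
  rewrite /= (eq_bigl (fun s : 0.-tuple T => A [::])); last by move=> s; rewrite tuple0.
  rewrite big_mkcond /= (bigD1 [tuple]) //= [X in _ + X]big1; last first.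
    by move=> s; rewrite (tuple0 s) => /eqP.
  by rewrite addr0 big_nil; case: (A _).
rewrite /= (reindex (fun xs : T * n.-tuple T => cons_tuple xs.1 xs.2)) /=; last first.
  exists (fun t : n.+1.-tuple T => (thead t, [tuple of behead t])) => [[x t] _|t _] /=.
    by congr pair; apply/val_inj.
  by case/tupleP: t => x t; apply/val_inj.
rewrite big_mkcond -(pair_bigA _ (fun x (t : n.-tuple T) =>
  if A (x :: t) then \prod_(y <- x :: t) q y else 0)) /=.
apply: eq_bigr => x _; rewrite -IH big_distrr /= [RHS]big_mkcond /=.
by apply: eq_bigr => t _; rewrite big_cons; case: (A _).
Qed.

Lemma iidZ q n c F : iid q n (fun s => c * F s) = c * iid q n F.
Proof.
elim: n F => [|n IH] F //=; rewrite big_distrr /=.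
by apply: eq_bigr => x _; rewrite IH mulrCA.
Qed.

Lemma iidD q n F G : iid q n (fun s => F s + G s) = iid q n F + iid q n G.
Proof.
elim: n F G => [|n IH] F G //=; rewrite -big_split /=.
by apply: eq_bigr => x _; rewrite IH mulrDr.
Qed.

Lemma iid_sum (I : Type) (r : seq I) (P : pred I) q n (F : I -> seq T -> R) :
  iid q n (fun s => \sum_(i <- r | P i) F i s) = \sum_(i <- r | P i) iid q n (F i).
Proof.
elim: n F => [|n IH] F //=; rewrite exchange_big /=.
by apply: eq_bigr => x _; rewrite IH big_distrr.
Qed.

Lemma iid_prod q n f :
  iid q n (fun s => \prod_(x <- s) f x) = (\sum_x q x * f x) ^+ n.
Proof.
elim: n => [|n IH] /=; first by rewrite big_nil expr0.
rewrite exprS big_distrl /=; apply: eq_bigr => x _.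
rewrite -mulrA -IH -[X in _ = _ * X]iidZ; congr (_ * _).
by apply: eq_iid => s _; rewrite big_cons.
Qed.

Lemma iid_cst q n c : iid q n (fun=> c) = c * (\sum_x q x) ^+ n.
Proof.
have -> : \sum_x q x = \sum_x q x * 1 by apply: eq_bigr => x _; rewrite mulr1.
rewrite -iid_prod -iidZ; apply: eq_iid => s _.
by rewrite big1 ?mulr1.
Qed.

(** Serves to normalize a weight of total mass below 1 to a probability, so that Chernoff bounds
    apply to it. *)
Lemma iidZw c q n F : iid (fun x => c * q x) n F = c ^+ n * iid q n F.
Proof.
elim: n F => [|n IH] F /=; first by rewrite mul1r.
rewrite big_distrr /=; apply: eq_bigr => x _.
by rewrite IH exprS; ring.
Qed.

Section Nonneg.
Variables (q : T -> R) (q_ge0 : forall x, 0 <= q x).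

Lemma le_iid n F G :
  (forall s, size s = n -> F s <= G s) -> iid q n F <= iid q n G.
Proof.
elim: n F G => [|n IH] F G FG /=; first exact: FG.
apply: ler_sum => x _; apply: ler_wpM2l => //.
by apply: IH => s sn; apply: FG; rewrite /= sn.
Qed.

Lemma iid_ge0 n F : (forall s, size s = n -> 0 <= F s) -> 0 <= iid q n F.
Proof.
move=> F0; have := le_iid n (fun=> 0) F F0.
by rewrite iid_cst mul0r.
Qed.

End Nonneg.

Section Probability.
Variables (q : T -> R) (q_ge0 : forall x, 0 <= q x) (q_sum : \sum_x q x = 1).

(** The letters after position [m] integrate out because [q] has mass 1. *)
Lemma iid_take n m F : (m <= n)%N -> iid q n (fun s => F (take m s)) = iid q m F.
Proof.
elim: n m F => [|n IH] [|m] F //= mn.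
  under eq_bigr => x _.
    rewrite iid_cst q_sum expr1n mulr1; over.
  by rewrite -big_distrl /= q_sum mul1r.
by apply: eq_bigr => x _; rewrite (IH m (fun s => F (x :: s))).
Qed.

(** From [expR (- x) >= 1 - x], the exponential is at most [1 / (1 - x)], and [(1 - x) * (1 + x + 2
    * x ^+ 2) = 1 + x ^+ 2 * (1 - 2 * x)] is at least 1 on this range. *)
Lemma expR_le_quadratic (x : R) : 0 <= x -> x <= 1/2 -> expR x <= 1 + x + 2 * x ^+ 2.
Proof.
move=> x0 x1; have h := expR_ge1Dx (- x).
have e0 := expR_gt0 x; have : expR x * expR (- x) = 1 by rewrite -expRD subrr expR0.
move=> e1; have : expR x * (1 - x) <= 1 by rewrite -[leRHS]e1 ler_wpM2l // ltW.
nra.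
Qed.

(** Exponential Markov inequality: the indicator is at most the exponential of [l] times the excess
    of the count over its threshold, and this exponential is a product over the letters. *)
Lemma iid_chernoff n (k : T) (eta : R) : 0 < eta -> eta <= 1 ->
  iid q n (fun s => ((q k + eta) * n%:R <= (count_mem k s)%:R)%R%:R)
    <= expR (- (eta ^+ 2 / 8)) ^+ n.
Proof.
move=> eta0 eta1; pose l := eta / 4.
have l0 : 0 <= l by rewrite /l; lra.
have l1 : l <= 1/2 by rewrite /l; lra.
have qk1 : q k <= 1.
  by rewrite -q_sum (bigD1 k) //= lerDl sumr_ge0.
pose f x := if x == k then expR l else 1.
have fE s : \prod_(x <- s) f x = expR (l * (count_mem k s)%:R).
  elim: s => [|x s IH]; first by rewrite big_nil mulr0 expR0.
  rewrite big_cons IH /= /f natrD mulrDr expRD; case: (x == k) => /=.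
    by rewrite mulr1.
  by rewrite mulr0 expR0.
apply: (@le_trans _ _ (iid q n (fun s => expR (- (l * ((q k + eta) * n%:R))) *
    \prod_(x <- s) f x))).
  apply: le_iid => // s _; rewrite fE -expRD.
  case h: ((q k + eta) * n%:R <= (count_mem k s)%:R)%R => /=; last exact: expR_ge0.
  apply: le_trans (expR_ge1Dx _); rewrite lerDl.
  have : l * ((q k + eta) * n%:R) <= l * (count_mem k s)%:R by apply: ler_wpM2l.
  lra.
rewrite iidZ iid_prod.
have -> : \sum_x q x * f x = 1 + q k * (expR l - 1).
  have q1 : q k + \sum_(x | x != k) q x = 1 by rewrite -q_sum [in RHS](bigD1 k).
  rewrite (bigD1 k) //= /f eqxx (eq_bigr q); last by move=> x /negbTE ->; rewrite mulr1.
  lra.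
have -> : expR (- (l * ((q k + eta) * n%:R))) = expR (- (l * (q k + eta))) ^+ n.
  by rewrite -expRM_natl; congr expR; ring.
rewrite -exprMn; apply: lerXn2r; rewrite ?nnegrE ?expR_ge0 //.
  rewrite mulr_ge0 ?expR_ge0 // addr_ge0 // mulr_ge0 // subr_ge0.
  by apply: le_trans (expR_ge1Dx _); lra.
apply: (@le_trans _ _ (expR (- (l * (q k + eta))) * expR (q k * (l + 2 * l ^+ 2)))).
  rewrite ler_wpM2l ?expR_ge0 //; apply: le_trans (expR_ge1Dx _).
  rewrite lerD2l ler_wpM2l //; have := expR_le_quadratic l l0 l1; lra.
rewrite -expRD ler_expR /l.
have : q k * eta ^+ 2 <= eta ^+ 2 by rewrite ler_piMl ?sqr_ge0.
lra.
Qed.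

End Probability.

(** Induction on the first letter: starting with [x] accounts for the fraction [r x / n.+1] of the
    multinomial term, and these fractions add up to 1. *)
Lemma iid_multinomial q n (r : T -> nat) : (\sum_x r x = n)%N ->
  iid q n (fun s => [forall x, count_mem x s == r x]%:R) =
    (n`!)%:R / (\prod_x ((r x)`!)%:R) * \prod_x q x ^+ r x.
Proof.
have fact_neq0 (r' : T -> nat) : \prod_x ((r' x)`!)%:R != 0 :> R.
  by rewrite prodf_seq_neq0; apply/allP => x _; rewrite pnatr_eq0 -lt0n fact_gt0.
elim: n r => [|n IH] r rn.
  have r0 x : r x = 0%N by apply/eqP; move/eqP: rn; rewrite sum_nat_eq0 => /forallP /(_ x).
  rewrite /= (_ : [forall x, _]); last by apply/forallP => x; rewrite r0.
  rewrite !big1 ?divr1 ?mulr1 // => x _; by rewrite r0 // expr0.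
(* The counts still to be realized after a first letter [x]. The subtraction truncates only if
   [r x = 0], and then no word with these counts starts with [x]. *)
pose r' x y := (r y - (x == y))%N.
rewrite /=.
transitivity (\sum_x (r x)%:R * ((n`!)%:R / (\prod_x ((r x)`!)%:R) * \prod_x q x ^+ r x)).
  apply: eq_bigr => x _; case: (posnP (r x)) => [rx0|rx].
    rewrite rx0 mul0r (@eq_iid _ _ _ (fun=> 0)) ?iid_cst ?mul0r ?mulr0 // => s _.
    by rewrite (_ : [forall _, _] = false) //; apply/negbTE/forallPn; exists x; rewrite rx0 eqxx.
  rewrite (@eq_iid _ _ _ (fun s => [forall y, count_mem y s == r' x y]%:R)); last first.
    move=> s _; congr ((_ : bool)%:R); apply: eq_forallb => y; rewrite /r'.
    case: (eqVneq x y) => [<-|_] /=; last by rewrite subn0.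
    by lia.
  have r'n : (\sum_y r' x y = n)%N.
    apply/eqP; rewrite -eqSS -rn (bigD1 x) //= [X in _ == X](bigD1 x) //= /r' eqxx.
    rewrite (eq_bigr r) => [|y]; last by rewrite eq_sym => /negbTE ->; rewrite subn0.
    by lia.
  rewrite (IH _ r'n).
  have e1 : \prod_y ((r y)`!)%:R = (r x)%:R * \prod_y ((r' x y)`!)%:R :> R.
    rewrite (bigD1 x) //= [in RHS](bigD1 x) //= mulrA /r' eqxx; congr (_ * _).
      by rewrite -natrM; case: (r x) rx => // m _; rewrite subn1 /= factS.
    by apply: eq_bigr => y; rewrite eq_sym => /negbTE ->; rewrite subn0.
  have e2 : \prod_y q y ^+ r y = q x * \prod_y q y ^+ r' x y.
    rewrite (bigD1 x) //= [in RHS](bigD1 x) //= mulrA /r' eqxx; congr (_ * _).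
      by rewrite -exprS; case: (r x) rx => // m _; rewrite subn1.
    by apply: eq_bigr => y; rewrite eq_sym => /negbTE ->; rewrite subn0.
  rewrite e1 e2; have := fact_neq0 (r' x).
  have : (r x)%:R != 0 :> R by rewrite pnatr_eq0 -lt0n.
  by move=> h1 h2; field; rewrite h1 h2.
rewrite -big_distrl /= -natr_sum rn factS natrM; ring.
Qed.

End IidExpectation.

(** * Asymptotics of the expected stopping time from an exponential rate of the error *)

Section StoppingTime.
Context {R : realType} {T : finType}.
Variables (q : T -> R) (q_ge0 : forall x, 0 <= q x) (q_sum : \sum_x q x = 1).
Variables (g : seq T -> R) (D c : R).
Hypotheses (D_gt0 : 0 < D) (c_gt0 : 0 < c) (c_le1 : c <= 1).
Hypothesis g_ge : forall s, (0 < size s)%N -> c ^+ size s <= g s.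
Hypothesis g_rate : forall e : R, 0 < e ->
  exists (bad : pred (seq T)) (M rho : R),
    [/\ 0 <= M, 0 < rho < 1,
        forall n, iid q n (fun s => (bad s)%:R) <= M * rho ^+ n &
        forall s, (0 < size s)%N -> ~~ bad s ->
          expR (- ((size s)%:R * (D + e))) <= g s <= expR (- ((size s)%:R * (D - e)))].

(** Here [g] stands for one minus the posterior, so this is the probability that the stopping time
    exceeds [n]. The floor [g_ge] holds on every sample, the rate [g_rate] only off an event of
    exponentially small probability. *)
Definition surv (d : R) (n : nat) : R :=
  iid q n (fun s => [forall m : 'I_n, (d < g (take m.+1 s))%R]%:R).

Lemma surv_ge0 d n : 0 <= surv d n.
Proof. by apply: iid_ge0 => // s _; rewrite ler0n. Qed.

Lemma surv_le1 d n : surv d n <= 1.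
Proof.
have := iid_cst q n 1; rewrite q_sum expr1n mulr1 => <-.
by apply: le_iid => // s _; rewrite lern1 leq_b1.
Qed.

Lemma sum_nat_le_bound (N : nat) (x : R) : 0 <= x ->
  \sum_(0 <= n < N) (n%:R <= x)%R%:R <= x + 1.
Proof.
(* The first bound feeds the induction for the second: if the last indicator is 1, the earlier ones
   sum to at most [N], and [N <= x]. *)
move=> x0; suff : \sum_(0 <= n < N) (n%:R <= x)%R%:R <= N%:R :> R /\
  \sum_(0 <= n < N) (n%:R <= x)%R%:R <= x + 1 by case.
elim: N => [|N [IH1 IH2]]; first by rewrite big_nil; split => //; lra.
rewrite big_nat_recr //= -natr1; case h: (N%:R <= x)%R => /=; split; lra.
Qed.

Lemma geometric_sum_le (N : nat) (rho : R) : 0 < rho < 1 ->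
  \sum_(0 <= n < N) rho ^+ n <= (1 - rho)^-1.
Proof.
move=> /andP[r0 r1]; rewrite -[leRHS]mul1r ler_pdivlMr ?subr_gt0 //.
suff : (\sum_(0 <= n < N) rho ^+ n) * (1 - rho) = 1 - rho ^+ N.
  by move=> ->; rewrite gerBl exprn_ge0 // ltW.
elim: N => [|N IH]; first by rewrite big_nil mul0r expr0 subrr.
by rewrite big_nat_recr //= mulrDl IH exprS; ring.
Qed.

Lemma geometric_tail_le (t n : nat) (rho : R) : 0 < rho < 1 ->
  \sum_(0 <= m < n | (t <= m.+1)%N) rho ^+ m.+1 <= rho ^+ t / (1 - rho).
Proof.
move=> /andP[r0 r1]; rewrite ler_pdivlMr ?subr_gt0 //.
(* The telescoped remainder is kept in the invariant; the maximum covers the indices where no term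
   has entered the sum yet. *)
suff : (\sum_(0 <= m < n | (t <= m.+1)%N) rho ^+ m.+1) * (1 - rho) +
    rho ^+ maxn t n.+1 <= rho ^+ t.
  by apply: le_trans; rewrite lerDl exprn_ge0 // ltW.
elim: n => [|n IH].
  rewrite big_nil mul0r add0r; apply: ler_wiXn2l; rewrite ?ltW //; exact: leq_maxl.
rewrite big_mkcond big_nat_recr //= -big_mkcond /=; case: leqP => h.
  have e1 : maxn t n.+1 = n.+1 by lia.
  have e2 : maxn t n.+2 = n.+2 by lia.
  move: IH; rewrite e1 e2 (exprS _ n.+1); lra.
have -> : maxn t n.+2 = maxn t n.+1 by lia.
by rewrite addr0.
Qed.

(** Once [n] exceeds [ln d^-1 / (D - e)], surviving at time [n] forces the sample of length [n]
    itself to be bad, so the later terms form a geometric series whose sum does not depend on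
    [d]. *)
Lemma surv_sum_upper (e : R) : 0 < e -> e < D -> exists M : R,
  forall d : R, 0 < d -> d < 1 -> forall N,
    \sum_(0 <= n < N) surv d n <= ln d^-1 / (D - e) + M.
Proof.
move=> e0 eD; have [bad [M [rho [M0 rho01 Hbad Hg]]]] := g_rate e e0.
exists (1 + M * (1 - rho)^-1) => d d0 d1 N.
have l0 : 0 < ln d^-1 by rewrite ln_gt0 // invf_gt1.
have De : 0 < D - e by lra.
apply: (@le_trans _ _ (\sum_(0 <= n < N)
    ((n%:R <= ln d^-1 / (D - e))%R%:R + M * rho ^+ n))); last first.
  rewrite big_split /= -mulr_sumr addrA lerD //.
    by apply: sum_nat_le_bound; rewrite divr_ge0 ?ltW.
  by apply: ler_wpM2l => //; exact: geometric_sum_le.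
apply: ler_sum => n _; case h: (n%:R <= _)%R => /=.
  apply: le_trans (surv_le1 d n) _; rewrite lerDl mulr_ge0 // exprn_ge0 //.
  by case/andP: rho01 => /ltW.
rewrite add0r; apply: le_trans (Hbad n); apply: le_iid => // s sn.
case hb: (bad s) => /=; first by rewrite lern1 leq_b1.
rewrite lern0 eqb0; apply/negP => /forallP H.
move/negbT: h; rewrite -ltNge ltr_pdivrMr // => h.
have n0 : (0 < n)%N.
  by rewrite lt0n; apply/negP => /eqP n0; move: h; rewrite n0 mul0r; lra.
case: n n0 sn h H => // n _ sn h H; have := H ord_max.
rewrite /= -sn take_size => dg.
have := Hg s; rewrite sn hb => /(_ isT isT)/andP[_]; apply/negP; rewrite -ltNge.
apply: le_lt_trans dg; rewrite -[leRHS]invrK -[X in X^-1]lnK ?posrE ?invr_gt0 //.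
by rewrite -expRN ler_expR lerN2 ltW.
Qed.

(** A stop at a time of at most [n] happens either before [t], which the floor on [g] excludes, or
    on a bad prefix of length at least [t]; the latter has total probability at most [e] by the
    choice of [t]. *)
Lemma surv_lower (e : R) : 0 < e -> exists2 d0 : R, 0 < d0 &
  forall d : R, 0 < d -> d < d0 -> forall n,
    n%:R * (D + e) < ln d^-1 -> 1 - e <= surv d n.
Proof.
move=> e0; have [bad [M [rho [M0 rho01 Hbad Hg]]]] := g_rate e e0.
have [t Ht] : exists t, M * (rho ^+ t / (1 - rho)) <= e.
  have r1 : 0 < 1 - rho by lra.
  have : (rho ^+ n @[n --> \oo] --> (0 : R)).
    by apply: cvg_expr; rewrite ger0_norm; lra.
  move=> /cvgrPdist_le /(_ (e * (1 - rho) / (M + 1))).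
  have pos : 0 < e * (1 - rho) / (M + 1) by rewrite divr_gt0 ?mulr_gt0 //; lra.
  move=> /(_ pos) [t _ /(_ t (leqnn t))] /=.
  rewrite sub0r normrN ger0_norm ?exprn_ge0 //; last by lra.
  rewrite ler_pdivlMr; last by lra.
  move=> h; exists t; rewrite mulrA ler_pdivrMr //; apply: le_trans h.
  by rewrite mulrC ler_wpM2l ?exprn_ge0 //; lra.
(* Below this threshold [g] stays above [d] at every time up to [t], whatever the sample. *)
exists (c ^+ t); first by rewrite exprn_gt0.
move=> d d0 dc n nl.
have dE : d = expR (- ln d^-1) by rewrite expRN lnK ?posrE ?invr_gt0 // invrK.
(* Union bound inside the integral: the survival indicator is at least one minus the number of bad
   prefixes of length at least [t]. *)
apply: (@le_trans _ _ (iid q n (fun s => 1 +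
    -1 * \sum_(0 <= m < n | (t <= m.+1)%N) (bad (take m.+1 s))%:R))); last first.
  apply: le_iid => // s sn.
  case H: [forall _, _] => /=.
    by rewrite mulN1r gerBl sumr_ge0.
  move/negbT/forallPn: H => [m]; rewrite -leNgt => gd.
  have szm : size (take m.+1 s) = m.+1 by rewrite size_takel // sn ltn_ord.
  have tm : (t <= m.+1)%N.
    rewrite leqNgt; apply/negP => mt.
    have := g_ge (take m.+1 s); rewrite szm => /(_ isT) h.
    have : c ^+ t <= c ^+ m.+1 by apply: ler_wiXn2l; rewrite ?(ltW c_gt0) // ltnW.
    lra.
  have bm : bad (take m.+1 s).
    apply/negPn/negP => nb.
    have := Hg (take m.+1 s); rewrite szm => /(_ isT nb)/andP[h _].
    have : d < expR (- (m.+1%:R * (D + e))).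
      rewrite [ltLHS]dE ltr_expR ltrN2; apply: le_lt_trans nl.
      by rewrite ler_pM2r ?addr_gt0 // ler_nat ltn_ord.
    lra.
  rewrite mulN1r subr_le0 big_mkord (bigD1 m) //= bm lerDl.
  exact: sumr_ge0.
have -> : iid q n (fun s => 1 +
    -1 * \sum_(0 <= m < n | (t <= m.+1)%N) (bad (take m.+1 s))%:R) =
    1 - \sum_(0 <= m < n | (t <= m.+1)%N) iid q m.+1 (fun s => (bad s)%:R).
  rewrite iidD iid_cst q_sum expr1n mulr1 iidZ mulN1r iid_sum; congr (_ - _).
  rewrite !big_mkord; apply: eq_bigr => m _.
  by rewrite (@iid_take _ _ _ q_sum n m.+1 (fun s => (bad s)%:R)).
rewrite lerD2l lerN2; apply: le_trans Ht.
apply: (@le_trans _ _ (\sum_(0 <= m < n | (t <= m.+1)%N) M * rho ^+ m.+1)).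
  by apply: ler_sum => m _; exact: Hbad.
by rewrite -mulr_sumr ler_wpM2l // geometric_tail_le.
Qed.

Lemma surv_sum_lower (e : R) : 0 < e -> e < 1 -> exists2 d0 : R, 0 < d0 &
  forall d : R, 0 < d -> d < d0 -> exists N,
    ln d^-1 * ((1 - e) / (D + 2 * e)) <= \sum_(0 <= n < N) surv d n.
Proof.
move=> e0 e1; have [d0 d00 H] := surv_lower e e0.
exists (Num.min d0 1); first by rewrite lt_min d00 ltr01.
move=> d dp; rewrite lt_min => /andP[dd0 d1].
have l0 : 0 < ln d^-1 by rewrite ln_gt0 // invf_gt1.
have De : 0 < D + 2 * e by rewrite addr_gt0 ?mulr_gt0.
(* The doubled slack gives the strict inequality [n%:R * (D + e) < ln d^-1] for all [n] up to
   [x]. *)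
pose x := ln d^-1 / (D + 2 * e).
have x0 : 0 < x by rewrite divr_gt0.
exists (Num.trunc x).+1.
apply: (@le_trans _ _ (\sum_(0 <= n < (Num.trunc x).+1) (1 - e))).
  rewrite sumr_const_nat subn0 -[leRHS]mulr_natr mulrCA ler_pM2l ?subr_gt0 //.
  by rewrite ltW // truncnS_gt.
rewrite !big_mkord; apply: ler_sum => n _; apply: H => //.
have nx : (nat_of_ord n)%:R <= x.
  have := ltn_ord n; rewrite ltnS -(ler_nat R) => h; apply: le_trans h _.
  by rewrite truncn_le ltW.
have xl : x * (D + 2 * e) = ln d^-1 by rewrite divfK // gt_eqF.
rewrite -xl; apply: (@le_lt_trans _ _ (x * (D + e))).
  by rewrite ler_wpM2r // addr_ge0 // ltW.
by rewrite ltr_pM2l // ltrD2l; lra.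
Qed.

(** For fixed [e] the normalized sum is eventually finite and lies between [(1 - e) / (D + 2 * e)]
    and [(D - e)^-1 + e]; both ends tend to [D^-1] as [e] tends to 0. *)
Lemma stopping_time_cvg :
  ((\sum_(0 <= n <oo) (surv d n)%:E) * ((ln d^-1)^-1)%:E)%E @[d --> 0^'+]
    --> (D^-1)%:E.
Proof.
pose S (d : R) := (\sum_(0 <= n <oo) (surv d n)%:E)%E.
have S_ge d N : ((\sum_(0 <= n < N) surv d n)%:E <= S d)%E.
  rewrite -sumEFin; apply: nneseries_lim_ge => n _ _.
  by rewrite lee_fin surv_ge0.
have S_le d x : (forall N, \sum_(0 <= n < N) surv d n <= x) -> (S d <= x%:E)%E.
  move=> H; apply: lime_le.
    by apply: is_cvg_nneseries => n _ _; rewrite lee_fin surv_ge0.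
  by near=> N; rewrite sumEFin lee_fin.
have S_ge0 d : (0 <= S d)%E.
  by apply: nneseries_ge0 => n _ _; rewrite lee_fin surv_ge0.
have S_fin d x : (S d <= x%:E)%E -> S d = (fine (S d))%:E.
  move=> h; rewrite fineK // ge0_fin_numE //; exact: le_lt_trans h (ltry _).
have near_bounds (e : R) : 0 < e -> e < D -> e < 1 ->
    \forall d \near (0 : R)^'+,
     exists2 v, (S d * ((ln d^-1)^-1)%:E)%E = v%:E &
       (1 - e) / (D + 2 * e) <= v <= (D - e)^-1 + e.
  move=> e0 eD e1.
  have [M HM] := surv_sum_upper e e0 eD; have [d0 d00 Hd0] := surv_sum_lower e e0 e1.
  near=> d.
  have dp : 0 < d by near: d; exact: nbhs_right_gt.
  have d1 : d < 1 by near: d; exact: nbhs_right_lt.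
  have dd0 : d < d0 by near: d; exact: nbhs_right_lt.
  (* Makes the additive constant [M] at most [e * ln d^-1], hence at most [e] after
     normalization. *)
  have dM : d < expR (- (M / e)) by near: d; apply: nbhs_right_lt; rewrite expR_gt0.
  have l0 : 0 < ln d^-1 by rewrite ln_gt0 // invf_gt1.
  have lM : M <= e * ln d^-1.
    rewrite mulrC -ler_pdivrMr // lnV ?posrE // lerNr -[leRHS]expRK.
    by rewrite ler_ln ?posrE ?expR_gt0 // ltW.
  have up := S_le d _ (HM d dp d1).
  have [N HN] := Hd0 d dp dd0.
  have lo : ((ln d^-1 * ((1 - e) / (D + 2 * e)))%:E <= S d)%E.
    by apply: le_trans (S_ge d N); rewrite lee_fin.
  have Sf := S_fin _ _ up; move: up lo; rewrite Sf !lee_fin => up lo.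
  exists (fine (S d) / ln d^-1) => //.
  rewrite ler_pdivlMr // ler_pdivrMr //; apply/andP; split; first by rewrite mulrC.
  apply: le_trans up _; rewrite mulrDl lerD //.
  by rewrite mulrC.
apply: cvg_EFin.
  near (0 : R)^'+ => e.
  have e0 : 0 < e by near: e; exact: nbhs_right_gt.
  have eD : e < D by near: e; exact: nbhs_right_lt.
  have e1 : e < 1 by near: e; exact: nbhs_right_lt.
  by apply: filterS (near_bounds e e0 eD e1) => d [v -> _].
apply/cvgrPdist_le => eps eps0.
have lo : (1 - e) / (D + 2 * e) @[e --> (0 : R)^'+] --> D^-1.
  apply: cvg_at_right_filter; rewrite -[X in _ --> X](_ : (1 - 0) / (D + 2 * 0) = D^-1).
    apply: cvgM; first by apply: cvgB; [exact: cvg_cst|exact: cvg_id].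
    apply: cvgV; first by rewrite mulr0 addr0 gt_eqF.
    apply: cvgD; first exact: cvg_cst.
    by apply: cvgM; [exact: cvg_cst|exact: cvg_id].
  by rewrite subr0 mulr0 addr0 mul1r.
have hi : (D - e)^-1 + e @[e --> (0 : R)^'+] --> D^-1.
  apply: cvg_at_right_filter; rewrite -[X in _ --> X](_ : (D - 0)^-1 + 0 = D^-1).
    apply: cvgD; last exact: cvg_id.
    apply: cvgV; first by rewrite subr0 gt_eqF.
    by apply: cvgB; [exact: cvg_cst|exact: cvg_id].
  by rewrite subr0 addr0.
move/cvgrPdist_le: lo => /(_ eps eps0) lo.
move/cvgrPdist_le: hi => /(_ eps eps0) hi.
near (0 : R)^'+ => e.
have e0 : 0 < e by near: e; exact: nbhs_right_gt.
have eD : e < D by near: e; exact: nbhs_right_lt.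
have e1 : e < 1 by near: e; exact: nbhs_right_lt.
have lo_e : `|D^-1 - (1 - e) / (D + 2 * e)| <= eps by near: e.
have hi_e : `|D^-1 - ((D - e)^-1 + e)| <= eps by near: e.
apply: filterS (near_bounds e e0 eD e1) => d [v /= -> /andP[v1 v2]] /=.
move: lo_e hi_e; rewrite !ler_norml => /andP[_ lo_e] /andP[hi_e _]; apply/andP; split; lra.
Unshelve. all: by end_near. Qed.

End StoppingTime.

(** * Effect of a permutation of the labels on the weight of an assignment *)

Section LabelSwap.
Context {R : realType} {K L : nat} {p : nat -> R} {ns : seq nat}.
Hypothesis p_gt0 : forall k : 'I_K, 0 < p k.
Hypothesis ns_sorted : forall i j, (i <= j)%N -> (nth 0 ns j <= nth 0 ns i)%N.

Local Notation assignment := {ffun 'I_(Ln L ns) -> 'I_K}.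
Local Notation remainder := {ffun 'I_K -> 'I_(vd L ns).+1}.
Implicit Types (psi : assignment) (r : remainder) (sg : {perm 'I_K}).

Definition relabel sg psi : assignment := [ffun i => sg (psi i)].

Lemma relabel_inj sg : injective (relabel sg).
Proof.
move=> f g /ffunP fg; apply/ffunP => i; have := fg i.
by rewrite !ffunE => /perm_inj.
Qed.

Lemma injectiveb_relabel sg psi : injectiveb (relabel sg psi) = injectiveb psi.
Proof.
apply/injectiveP/injectiveP => h i j.
  by move=> ij; apply: h; rewrite !ffunE ij.
by rewrite !ffunE => /perm_inj /h.
Qed.

Lemma inJ_relabel sg psi j : inJ (relabel sg psi) (sg j) = inJ psi j.
Proof.
rewrite /inJ; congr (~~ _); apply/codomP/codomP => -[i]; rewrite ?ffunE.
  by move=> /perm_inj ->; exists i.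
by move=> ->; exists i; rewrite ffunE.
Qed.

(* The full vector of occurrence counts, indexed by labels, that [(psi, r)] encodes. *)
Definition alloc psi r (k : 'I_K) : nat :=
  if inJ psi k then nat_of_ord (r k) else (\sum_(i | psi i == k) nth 0 ns i)%N.

(** The part of a term that does not involve [p], and so is invariant under relabelling. *)
Definition multiplicity psi r : R :=
  wr R psi r *
    ((nbar L ns)`!%:R / \prod_(j | inJ psi j) (nat_of_ord (r j))`!%:R).

Lemma multiplicity_ge0 psi r : 0 <= multiplicity psi r.
Proof.
by rewrite mulr_ge0 ?divr_ge0 ?invr_ge0 ?prodr_ge0.
Qed.

Lemma psi_weight_relabel sg psi :
  psi_weight p (relabel sg psi) =
    \sum_(r | admissible psi r) multiplicity psi r * \prod_k p (sg k) ^+ alloc psi r k.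
Proof.
(* Remainders travel with the labels: under [h r] the label [sg k] gets the count that [k] had under
   [r]. *)
pose h (r : remainder) : remainder := [ffun k => r ((sg^-1)%g k)].
have h_inj : injective h.
  move=> r1 r2 /ffunP r12; apply/ffunP => k; have := r12 (sg k).
  by rewrite !ffunE permK.
have hE r k : h r (sg k) = r k by rewrite ffunE permK.
rewrite /psi_weight /Stilde (reindex_inj h_inj) /= big_distrr /=.
have adm r : admissible (relabel sg psi) (h r) = admissible psi r.
  rewrite /admissible; congr (_ && _).
    apply/forallP/forallP => H j.
      by have := H (sg j); rewrite inJ_relabel hE.
    by have := H ((sg^-1)%g j); rewrite -(inJ_relabel sg) -hE permKV.
  rewrite (reindex_inj (@perm_inj _ sg)) /=.
  by under eq_bigl do rewrite inJ_relabel; under eq_bigr do rewrite hE.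
apply: eq_big => [r|r _]; first exact: adm.
have mrE : mr (relabel sg psi) (h r) = mr psi r.
  rewrite /mr -!sum1_card (reindex_inj (@perm_inj _ sg)) /=.
  by apply: eq_bigl => j; rewrite !inE inJ_relabel hE.
have facE : \prod_(j | inJ (relabel sg psi) j) (nat_of_ord (h r j))`!%:R =
    \prod_(j | inJ psi j) (nat_of_ord (r j))`!%:R :> R.
  rewrite (reindex_inj (@perm_inj _ sg)) /=.
  by under eq_bigl do rewrite inJ_relabel; under eq_bigr do rewrite hE.
have powE : \prod_(j | inJ (relabel sg psi) j) p j ^+ h r j =
    \prod_(j | inJ psi j) p (sg j) ^+ r j :> R.
  rewrite (reindex_inj (@perm_inj _ sg)) /=.
  by under eq_bigl do rewrite inJ_relabel; under eq_bigr do rewrite hE.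
rewrite facE powE /wr mrE -/(wr R psi r) mulrCA; congr (_ * _).
rewrite [RHS](bigID (inJ psi)) /= mulrC; congr (_ * _).
  by apply: eq_bigr => j; rewrite /alloc => ->.
(* The ranks are grouped by the label they receive, to match the second branch of [alloc]. *)
rewrite (partition_big psi (fun k => ~~ inJ psi k)) /=; last first.
  by move=> i _; rewrite negbK codom_f.
apply: eq_bigr => k /negbTE kJ; rewrite /alloc kJ.
rewrite -prodrXr; apply: eq_bigr => i /eqP <-; by rewrite ffunE.
Qed.

Lemma psi_weightE psi :
  psi_weight p psi =
    \sum_(r | admissible psi r) multiplicity psi r * \prod_(k : 'I_K) p k ^+ alloc psi r k.
Proof.
have {1}-> : psi = relabel 1 psi by apply/ffunP => i; rewrite ffunE perm1.
rewrite psi_weight_relabel; apply: eq_bigr => r _; congr (_ * _).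
by apply: eq_bigr => k _; rewrite perm1.
Qed.

Lemma psi_weight_ge0 psi : 0 <= psi_weight p psi.
Proof.
rewrite psi_weightE sumr_ge0 // => r _.
by rewrite mulr_ge0 ?multiplicity_ge0 // prodr_ge0 // => k _; rewrite exprn_ge0 // ltW.
Qed.

Lemma prod_alloc_swap (a b : 'I_K) psi r : (alloc psi r b <= alloc psi r a)%N ->
  \prod_(k : 'I_K) p (tperm a b k) ^+ alloc psi r k =
  (p b / p a) ^+ (alloc psi r a - alloc psi r b) * \prod_(k : 'I_K) p k ^+ alloc psi r k.
Proof.
move=> ab; case: (eqVneq a b) => [<-|ne].
  rewrite divff ?gt_eqF // expr1n mul1r; apply: eq_bigr => k _.
  by rewrite tperm1 perm1.
rewrite (bigD1 a) //= (bigD1 b) 1?eq_sym //= [in RHS](bigD1 a) //= [in RHS](bigD1 b) 1?eq_sym //=.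
rewrite tpermL tpermR !mulrA; congr (_ * _); last first.
  by apply: eq_bigr => k /andP[ka kb]; rewrite tpermD // eq_sym.
move: ab; set x := alloc _ _ a; set y := alloc _ _ b => yx.
rewrite -{1 3}(subnK yx) !exprD expr_div_n.
have /lt0r_neq0 pa := p_gt0 a; field.
by rewrite expf_neq0.
Qed.

(** Termwise: exchanging [a] and [b] costs a power of [p b / p a] equal to the difference of their
    counts, here at most [m]. *)
Lemma psi_weight_swap_ge (a b : 'I_K) psi m : p b <= p a ->
  (forall r, admissible psi r ->
     (alloc psi r b <= alloc psi r a <= alloc psi r b + m)%N) ->
  (p b / p a) ^+ m * psi_weight p psi <= psi_weight p (relabel (tperm a b) psi).
Proof.
move=> ba H; rewrite psi_weight_relabel psi_weightE big_distrr /=.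
apply: ler_sum => r /H /andP[ab abm]; rewrite prod_alloc_swap // mulrCA.
rewrite ler_wpM2l ?multiplicity_ge0 // ler_wpM2r ?prodr_ge0 // => [k _|].
  by rewrite exprn_ge0 // ltW.
apply: ler_wiXn2l; rewrite ?leq_subLR // ?divr_ge0 ?(ltW (p_gt0 _)) //.
by rewrite ler_pdivrMr // mul1r.
Qed.

Lemma psi_weight_swap_le (a b : 'I_K) psi m : p b <= p a ->
  (forall r, admissible psi r -> (alloc psi r b + m <= alloc psi r a)%N) ->
  psi_weight p (relabel (tperm a b) psi) <= (p b / p a) ^+ m * psi_weight p psi.
Proof.
move=> ba H; rewrite psi_weight_relabel psi_weightE big_distrr /=.
apply: ler_sum => r /H abm.
rewrite prod_alloc_swap ?(leq_trans (leq_addr _ _) abm) // [leRHS]mulrCA.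
rewrite ler_wpM2l ?multiplicity_ge0 // ler_wpM2r ?prodr_ge0 // => [k _|].
  by rewrite exprn_ge0 // ltW.
apply: ler_wiXn2l; rewrite ?divr_ge0 ?(ltW (p_gt0 _)) //; last by lia.
by rewrite ler_pdivrMr // mul1r.
Qed.

Lemma alloc_codom psi r i : injective psi -> alloc psi r (psi i) = nth 0%N ns i.
Proof.
move=> inj; rewrite /alloc /inJ codom_f /= (bigD1 i) //= big1 ?addn0 // => j /andP[/eqP /inj ->].
by rewrite eqxx.
Qed.

(** A label missing from the first [m] ranks is either free, and then capped by [vd], the last
    listed count, or it holds a later rank. *)
Lemma alloc_le psi r k m : (m < Ln L ns)%N -> injective psi ->
  (forall i : 'I_(Ln L ns), (i < m)%N -> psi i != k) -> (alloc psi r k <= nth 0 ns m)%N.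
Proof.
move=> mL inj mk; case: (boolP (inJ psi k)) => kJ.
  rewrite /alloc kJ; apply: (@leq_trans (vd L ns)); first by rewrite -ltnS.
  by apply: ns_sorted; lia.
move: kJ; rewrite /inJ negbK => /codomP[i ki].
rewrite ki alloc_codom //; apply: ns_sorted; rewrite leqNgt; apply/negP => im.
by have := mk i im; rewrite ki eqxx.
Qed.

End LabelSwap.

(** * Bounds on the posterior odds by exchanging labels *)

Section PosteriorBounds.
Context {R : realType} {K L : nat} {p : nat -> R} {ns : seq nat}.
Variables l0 l1 : 'I_K.
Hypotheses (l0E : nat_of_ord l0 = 0%N) (l1E : nat_of_ord l1 = 1%N).
Hypothesis p_gt0 : forall k : 'I_K, 0 < p k.
Hypothesis p_le1 : forall k : 'I_K, k != l0 -> p k <= p l1.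
Hypothesis p_le0 : p l1 <= p l0.
Hypothesis ns_sorted : forall i j, (i <= j)%N -> (nth 0 ns j <= nth 0 ns i)%N.

Local Notation assignment := {ffun 'I_(Ln L ns) -> 'I_K}.
Implicit Types (psi : assignment) (P Q : pred assignment).

Definition mode_first psi :=
  [forall i : 'I_(Ln L ns), (nat_of_ord i == 0%N) ==> (nat_of_ord (psi i) == 0%N)].

Definition weight_of P : R := \sum_(psi : assignment | injectiveb psi && P psi) psi_weight p psi.

Lemma weight_of_ge0 P : 0 <= weight_of P.
Proof. by rewrite sumr_ge0 // => psi _; exact: psi_weight_ge0. Qed.

Lemma le_weight_of P Q : (forall psi, injective psi -> P psi -> Q psi) ->
  weight_of P <= weight_of Q.
Proof.
move=> PQ; rewrite /weight_of big_mkcond [leRHS]big_mkcond /=; apply: ler_sum => psi _.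
case: (boolP (injectiveb psi)) => //= /injectiveP inj.
case hP: (P psi); first by rewrite (PQ psi inj hP).
by case: ifP => // _; exact: psi_weight_ge0.
Qed.

Lemma eq_weight_of P Q : P =1 Q -> weight_of P = weight_of Q.
Proof. by move=> PQ; apply: eq_bigl => psi; rewrite PQ. Qed.

Lemma weight_of_relabel sg P :
  weight_of P = \sum_(psi : assignment | injectiveb psi && P (relabel sg psi)) psi_weight p (relabel sg psi).
Proof.
rewrite /weight_of (reindex_inj (@relabel_inj _ _ _ sg)) /=.
by apply: eq_bigl => psi; rewrite injectiveb_relabel.
Qed.

Lemma agg_posteriorE : agg_posterior K L p ns =
  weight_of mode_first / (weight_of mode_first + weight_of (predC mode_first)).
Proof. by rewrite /agg_posterior [X in _ / X](bigID mode_first). Qed.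

Lemma agg_error_le x : 0 <= x ->
  weight_of (predC mode_first) <= x * weight_of mode_first ->
  0 < weight_of mode_first + weight_of (predC mode_first) ->
  1 - agg_posterior K L p ns <= x.
Proof.
rewrite agg_posteriorE; set A := weight_of mode_first; set B := weight_of _ => x0 BA AB.
have A0 : 0 <= A := weight_of_ge0 _; have B0 : 0 <= B := weight_of_ge0 _.
rewrite lerBlDl -lerBlDr ler_pdivlMr //; nra.
Qed.

Lemma agg_error_ge y z : 0 < y -> 0 <= z ->
  y * weight_of mode_first <= z * weight_of (predC mode_first) ->
  y / (y + z) <= 1 - agg_posterior K L p ns.
Proof.
rewrite agg_posteriorE; set A := weight_of mode_first; set B := weight_of _ => y0 z0 AB.
have A0 : 0 <= A := weight_of_ge0 _; have B0 : 0 <= B := weight_of_ge0 _.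
have yz : 0 < y + z by lra.
(* If the total weight vanishes, division by 0 makes the posterior 0 and the error 1, and the bound
   still holds. *)
rewrite ler_pdivrMr //; case: (eqVneq (A + B) 0) => [->|AB0].
  by rewrite invr0 mulr0 subr0 mul1r; lra.
have ABp : 0 < A + B by rewrite lt_def AB0 addr_ge0.
have -> : 1 - A / (A + B) = B / (A + B) by field.
rewrite mulrAC ler_pdivlMr //; lra.
Qed.

Section RankedLabels.
Variable i0 : 'I_(Ln L ns).
Hypothesis i0E : nat_of_ord i0 = 0%N.
Local Notation n0 := (nth 0%N ns 0).
Local Notation n1 := (nth 0%N ns 1).
Let x := p l1 / p l0.

Lemma mode_ratio_gt0 : 0 < p l1 / p l0.
Proof. by rewrite divr_gt0. Qed.

Lemma neq_l01 : l1 != l0.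
Proof. by apply/eqP => /(congr1 val) /=; rewrite l0E l1E. Qed.

Lemma mode_firstE psi : mode_first psi = (psi i0 == l0).
Proof.
apply/forallP/eqP => [/(_ i0)|h i].
  by rewrite i0E /= => /eqP h; apply/val_inj; rewrite /= h l0E.
apply/implyP => /eqP i_0; have -> : i = i0 by apply/val_inj; rewrite /= i_0 i0E.
by rewrite h l0E.
Qed.

Lemma weight_of_other : weight_of (predC mode_first) =
  \sum_(a | a != l0) weight_of (fun psi : assignment => psi i0 == a).
Proof.
rewrite /weight_of (partition_big (fun psi : assignment => psi i0) (fun a => a != l0)) /=.
  apply: eq_bigr => a al; apply: eq_bigl => psi; rewrite mode_firstE -andbA; congr (_ && _).
  by case: (eqVneq (psi i0) a) => [->|_]; rewrite ?andbF // al.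
by move=> psi /andP[_]; rewrite mode_firstE.
Qed.

Lemma weight_first_swap a :
  weight_of (fun psi : assignment => psi i0 == a) =
  \sum_(psi : assignment | injectiveb psi && (psi i0 == l0)) psi_weight p (relabel (tperm l0 a) psi).
Proof.
rewrite (weight_of_relabel (tperm l0 a)); apply: eq_bigl => psi; congr (_ && _).
by rewrite ffunE; apply/eqP/eqP => [h|->]; [apply: (@perm_inj _ (tperm l0 a)); rewrite h|];
  rewrite tpermL.
Qed.

(** Exchanges [l0] and [l1] knowing only that [l1] is allotted between 0 and [n0] occurrences. One
    listed rank suffices, so this covers [L = 2] as well. *)
Lemma weight_mode_le_crude :
  x ^+ n0 * weight_of mode_first <= weight_of (predC mode_first).
Proof.
apply: (@le_trans _ _ (weight_of (fun psi : assignment => psi i0 == l1))); last first.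
  apply: le_weight_of => psi _ /= /eqP h; rewrite mode_firstE h; exact: neq_l01.
rewrite weight_first_swap (eq_weight_of mode_first (fun psi : assignment => psi i0 == l0)); last exact: mode_firstE.
rewrite /weight_of big_distrr /=; apply: ler_sum => psi /andP[/injectiveP inj /eqP h0].
apply: psi_weight_swap_ge => // r adm.
have e0 : alloc psi r l0 = n0 by rewrite -h0 alloc_codom // i0E.
have e1 : (alloc psi r l1 <= n0)%N.
  by apply: alloc_le => //; rewrite -{1}i0E.
by rewrite e0 e1 leq_addl.
Qed.

Hypothesis Ln_gt1 : (1 < Ln L ns)%N.

Lemma alloc_le_second psi r k : injective psi -> psi i0 = l0 -> k != l0 ->
  (alloc psi r k <= n1)%N.
Proof.
move=> inj h0 kl; apply: alloc_le => // i; rewrite ltnS leqn0 => /eqP i_0.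
have -> : i = i0 by apply/val_inj; rewrite /= i_0 i0E.
by rewrite h0 eq_sym.
Qed.

(** If another label [a] is first, exchange it with [l0]: the label being exchanged has at most [n1]
    occurrences, and [p a <= p l1]. The factor [K%:R] counts the choices of [a]. *)
Lemma weight_other_le :
  weight_of (predC mode_first) <= K%:R * x ^+ (n0 - n1) * weight_of mode_first.
Proof.
rewrite weight_of_other.
have xp := mode_ratio_gt0.
have wA := weight_of_ge0 mode_first.
apply: (@le_trans _ _ (\sum_(a : 'I_K | a != l0) x ^+ (n0 - n1) * weight_of mode_first)); last first.
  rewrite sumr_const -[leLHS]mulr_natl -mulrA ler_wpM2r ?mulr_ge0 ?exprn_ge0 ?(ltW xp) // ler_nat.
  by rewrite -[leqRHS]card_ord max_card.
apply: ler_sum => a al; rewrite weight_first_swap.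
rewrite (eq_weight_of mode_first (fun psi : assignment => psi i0 == l0)); last exact: mode_firstE.
rewrite /weight_of big_distrr /=; apply: ler_sum => psi /andP[/injectiveP inj /eqP h0].
have pa0 : p a <= p l0 by apply: le_trans p_le0; apply: p_le1.
apply: (@le_trans _ _ ((p a / p l0) ^+ (n0 - n1) * psi_weight p psi)).
  apply: psi_weight_swap_le => // r adm.
  have e0 : alloc psi r l0 = n0 by rewrite -h0 alloc_codom // i0E.
  have e1 := alloc_le_second psi r a inj h0 al.
  by rewrite e0 -[leqRHS](subnKC (ns_sorted 0 1 isT)) leq_add2r.
rewrite ler_wpM2r ?psi_weight_ge0 //.
apply: lerXn2r; rewrite ?nnegrE ?divr_ge0 ?(ltW (p_gt0 _)) //.
by rewrite ler_wpM2r ?invr_ge0 ?(ltW (p_gt0 _)) // p_le1.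
Qed.

(** The count of [l1] may be far below [n1], so exchanging [l0] and [l1] directly would lose too
    much. First [l1] is moved to the second rank, at the cost of a factor [K%:R]; then the two
    counts are exactly [n0] and [n1]. *)
Lemma weight_mode_le :
  x ^+ (n0 - n1) * weight_of mode_first <= K%:R * weight_of (predC mode_first).
Proof.
pose i1 : 'I_(Ln L ns) := Ordinal Ln_gt1.
pose A' := weight_of (fun psi : assignment => (psi i0 == l0) && (psi i1 == l1)).
have xp := mode_ratio_gt0; have l10 := neq_l01.
have i10 : i1 != i0 by apply/eqP => /(congr1 val) /=; rewrite i0E.
have A'0 : 0 <= A' by exact: weight_of_ge0.
have h1 : weight_of mode_first <= K%:R * A'.
  have -> : weight_of mode_first =
      \sum_b weight_of (fun psi : assignment => (psi i0 == l0) && (psi i1 == b)).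
    rewrite /weight_of (partition_big (fun psi : assignment => psi i1) xpredT) //=.
    apply: eq_bigr => b _; apply: eq_bigl => psi; by rewrite mode_firstE -andbA.
  apply: (@le_trans _ _ (\sum_(b : 'I_K) A')); last first.
    by rewrite sumr_const card_ord mulr_natl.
  apply: ler_sum => b _; case: (eqVneq b l0) => [->|bl].
    rewrite /weight_of big1 // => psi /andP[/injectiveP inj /andP[/eqP e0 /eqP e1]].
    by move: i10; rewrite -(inj_eq inj) e0 e1 eqxx.
  rewrite (weight_of_relabel (tperm l1 b)).
  rewrite (eq_bigl (fun psi : assignment => injectiveb psi && ((psi i0 == l0) && (psi i1 == l1)))); last first.
    move=> psi; congr (_ && _); rewrite !ffunE.
    have tl0 : tperm l1 b l0 = l0 by rewrite tpermD.
    by rewrite -{1}tl0 -{4}[b](tpermL l1) !(inj_eq perm_inj).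
  apply: ler_sum => psi /andP[/injectiveP inj /andP[/eqP e0 /eqP e1]].
  (* Exponent 0: trading [l1] at rank two for the less likely [b] cannot raise the weight, as [b] is
     allotted at most [n1]. *)
  rewrite -[leRHS]mul1r -(expr0 (p b / p l1)).
  apply: psi_weight_swap_le => // [|r adm]; first exact: p_le1.
  have := alloc_le_second psi r b inj e0 bl.
  by rewrite addn0 -e1 alloc_codom.
have h2 : x ^+ (n0 - n1) * A' <= weight_of (predC mode_first).
  apply: (@le_trans _ _ (weight_of (fun psi : assignment => (psi i0 == l1) && (psi i1 == l0)))); last first.
    apply: le_weight_of => psi _ /= /andP[/eqP h _]; by rewrite mode_firstE h.
  rewrite (weight_of_relabel (tperm l0 l1)).
  rewrite (eq_bigl (fun psi : assignment => injectiveb psi && ((psi i0 == l0) && (psi i1 == l1)))); last first.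
    move=> psi; congr (_ && _); rewrite !ffunE.
    by rewrite -{2}[l1](tpermL l0) -{5}[l0](tpermR _ l1) !(inj_eq perm_inj).
  rewrite /A' /weight_of big_distrr /=; apply: ler_sum => psi /andP[/injectiveP inj /andP[/eqP e0 /eqP e1]].
  apply: psi_weight_swap_ge => // r adm.
  have := ns_sorted 0 1 isT.
  have -> : alloc psi r l0 = n0 by rewrite -e0 alloc_codom // i0E.
  have -> : alloc psi r l1 = n1 by rewrite -e1 alloc_codom.
  by lia.
apply: (@le_trans _ _ (x ^+ (n0 - n1) * (K%:R * A'))).
  by rewrite ler_wpM2l // exprn_ge0 // ltW.
by rewrite mulrCA ler_wpM2l.
Qed.

End RankedLabels.
End PosteriorBounds.

(** * Ranked counts of a sample and positivity of the total weight *)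

Section SortedCounts.
Context {K : nat}.
Implicit Types (s : seq 'I_K) (k : 'I_K).

(** Keeps the labels that [sorted_counts] forgets, in a matching order. *)
Definition ranked_labels s : seq 'I_K :=
  sort (relpre (fun k => count_mem k s) geq) [seq k <- enum 'I_K | (0 < count_mem k s)%N].

Lemma sorted_countsE s :
  sorted_counts s = [seq count_mem k s | k <- ranked_labels s].
Proof. by rewrite /sorted_counts filter_map sort_map. Qed.

Lemma mem_ranked_labels s k : (k \in ranked_labels s) = (0 < count_mem k s)%N.
Proof. by rewrite mem_sort mem_filter mem_enum andbT. Qed.

Lemma ranked_labels_uniq s : uniq (ranked_labels s).
Proof. by rewrite sort_uniq filter_uniq ?enum_uniq. Qed.

Lemma nth_sorted_counts s k0 i : (i < size (ranked_labels s))%N ->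
  nth 0%N (sorted_counts s) i = count_mem (nth k0 (ranked_labels s) i) s.
Proof. by move=> i_lt; rewrite sorted_countsE (nth_map k0). Qed.

Lemma sorted_counts_nth_le s i j : (i <= j)%N ->
  (nth 0 (sorted_counts s) j <= nth 0 (sorted_counts s) i)%N.
Proof.
move=> ij; case: (ltnP j (size (sorted_counts s))) => [js|sj]; last first.
  by rewrite (nth_default _ sj).
have geq_trans : transitive geq by move=> a b c /= ab bc; exact: leq_trans bc ab.
have geq_refl : reflexive geq by move=> a /=.
apply: (sorted_leq_nth geq_trans geq_refl) => //; rewrite ?inE //.
  by apply: sort_sorted => a b /=; exact: leq_total.
exact: leq_ltn_trans js.
Qed.

Lemma sum_count_mem s : (\sum_(k : 'I_K) count_mem k s = size s)%N.
Proof.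
elim: s => [|x s IH] /=; first by rewrite big1.
rewrite big_split /= IH (bigD1 x) //= eqxx big1 ?addn0 // => k.
by rewrite eq_sym => /negbTE ->.
Qed.

Lemma sumn_sorted_counts s : sumn (sorted_counts s) = size s.
Proof.
rewrite sorted_countsE sumnE big_map.
rewrite (perm_big [seq k <- enum 'I_K | (0 < count_mem k s)%N]) /=; last first.
  by rewrite perm_sort.
rewrite big_filter -[RHS]sum_count_mem big_mkcond /= big_enum /=.
by apply: eq_bigr => k _; case: posnP.
Qed.

Lemma size_sorted_counts_gt0 s : (0 < size s)%N -> (0 < size (sorted_counts s))%N.
Proof.
by rewrite -sumn_sorted_counts; case: (sorted_counts s).
Qed.

Lemma index_sorted_counts s k : (0 < count_mem k s)%N ->
  [/\ (index k (ranked_labels s) < size (sorted_counts s))%N &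
      nth 0%N (sorted_counts s) (index k (ranked_labels s)) = count_mem k s].
Proof.
rewrite -mem_ranked_labels => ks.
have ik : (index k (ranked_labels s) < size (ranked_labels s))%N by rewrite index_mem.
by rewrite (nth_sorted_counts _ k) // nth_index // sorted_countsE size_map.
Qed.

Lemma count_le_first s k : (count_mem k s <= nth 0 (sorted_counts s) 0)%N.
Proof.
case: (posnP (count_mem k s)) => [->//|k0].
have [_ <-] := index_sorted_counts _ _ k0; exact: sorted_counts_nth_le.
Qed.

(** Several labels may be as likely as [k1], so the runner-up is not identified: it is only some
    label other than [k0], with a count at least that of [k1]. *)
Lemma top_two_counts s k0 k1 : k1 != k0 -> (0 < count_mem k1 s)%N ->
  (forall k, k != k0 -> (count_mem k s < count_mem k0 s)%N) ->
  [/\ nth 0%N (sorted_counts s) 0 = count_mem k0 s, (1 < size (sorted_counts s))%N,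
      (count_mem k1 s <= nth 0 (sorted_counts s) 1)%N &
      exists2 k, k != k0 & nth 0%N (sorted_counts s) 1 = count_mem k s].
Proof.
move=> k10 c1 ck; have c0 := leq_ltn_trans (leq0n _) (ck k1 k10).
have [i1s e1] := index_sorted_counts _ _ c1.
have sz : size (sorted_counts s) = size (ranked_labels s) by rewrite sorted_countsE size_map.
have h0 : nth k0 (ranked_labels s) 0 = k0.
  have s0 : (0 < size (ranked_labels s))%N by rewrite -sz; exact: leq_ltn_trans i1s.
  by apply/eqP/negPn/negP => /ck; rewrite -nth_sorted_counts // ltnNge count_le_first.
have i1 : (0 < index k1 (ranked_labels s))%N.
  rewrite lt0n; apply/negP => /eqP i1.
  have : nth k0 (ranked_labels s) (index k1 (ranked_labels s)) = k1.
    by rewrite nth_index // mem_ranked_labels.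
  by rewrite i1 h0 => e; rewrite e eqxx in k10.
have s1 : (1 < size (sorted_counts s))%N by apply: leq_ltn_trans i1s.
split => //.
- by rewrite (nth_sorted_counts _ k0) ?h0 // -sz ltnW.
- by rewrite -e1 sorted_counts_nth_le.
exists (nth k0 (ranked_labels s) 1); last by rewrite (nth_sorted_counts _ k0) // -sz.
by rewrite -{2}h0 nth_uniq ?ranked_labels_uniq // -sz ?(ltnW s1).
Qed.

Section Positivity.
Context {R : realType} {L : nat} {p : nat -> R}.
Hypothesis p_gt0 : forall k, 0 < p k.

Lemma multiplicity_gt0 ns (psi : {ffun 'I_(Ln L ns) -> 'I_K}) r :
  0 < multiplicity (R := R) psi r.
Proof.
rewrite mulr_gt0 ?divr_gt0 ?invr_gt0 ?ltr0n ?fact_gt0 ?bin_gt0 ?leq_addr //.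
by apply: prodr_gt0 => j _; rewrite ltr0n fact_gt0.
Qed.

(* The witness is the actual sample: [psi] lists its labels by decreasing count. *)
Lemma total_weight_gt0 s : (0 < size s)%N ->
  0 < weight_of (L := L) (p := p) (ns := sorted_counts s) (@mode_first K L (sorted_counts s)) +
      weight_of (p := p) (predC (@mode_first K L (sorted_counts s))).
Proof.
move=> s0; case: s s0 => // k0 s' _; set s := k0 :: s'; set ns := sorted_counts s.
have sz : size ns = size (ranked_labels s) by rewrite /ns sorted_countsE size_map.
have LnS : (Ln L ns <= size (ranked_labels s))%N by rewrite -sz geq_minr.
pose psi : {ffun 'I_(Ln L ns) -> 'I_K} := [ffun i : 'I_(Ln L ns) => nth k0 (ranked_labels s) i].
have iS (i : 'I_(Ln L ns)) : (i < size (ranked_labels s))%N.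
  exact: leq_trans (ltn_ord i) LnS.
have psi_inj : injective psi.
  move=> i j; rewrite !ffunE => /eqP; rewrite nth_uniq ?ranked_labels_uniq //.
  by move/eqP/val_inj.
have cv j : inJ psi j -> (count_mem j s <= vd L ns)%N.
  rewrite /inJ => jJ; case: (posnP (count_mem j s)) => [->//|j0].
  have [jS <-] := index_sorted_counts _ _ j0; apply: sorted_counts_nth_le.
  have : (Ln L ns <= index j (ranked_labels s))%N; last by lia.
  rewrite leqNgt; apply/negP => jL; move/negP: jJ; apply; apply/codomP.
  by exists (Ordinal jL); rewrite ffunE nth_index // mem_ranked_labels.
pose r : {ffun 'I_K -> 'I_(vd L ns).+1} :=
  [ffun j => if inJ psi j then inord (count_mem j s) else ord0].
have rE j : inJ psi j -> nat_of_ord (r j) = count_mem j s.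
  by move=> jJ; rewrite ffunE jJ inordK // ltnS cv.
have adm : admissible psi r.
  apply/andP; split; first by apply/forallP => j; apply/implyP => /negbTE jJ; rewrite ffunE jJ.
  rewrite (eq_bigr (fun j => count_mem j s)); last by move=> j; exact: rE.
  apply/eqP; rewrite /nbar sumn_sorted_counts -sum_count_mem [X in (X - _)%N](bigID (inJ psi)) /=.
  suff -> : (\sum_(j | ~~ inJ psi j) count_mem j s = sumn (take (Ln L ns) ns))%N by rewrite addnK.
  transitivity (\sum_(i < Ln L ns) count_mem (psi i) s)%N.
    rewrite [RHS](partition_big psi (fun j => ~~ inJ psi j)) /=; last first.
      by move=> i _; rewrite negbK codom_f.
    apply: eq_bigr => j; rewrite negbK => /codomP[i ->].
    by rewrite (big_pred1 i) // => i'; rewrite /= (inj_eq psi_inj).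
  rewrite sumnE (big_nth 0%N) size_takel ?sz // big_mkord.
  apply: eq_bigr => i _; rewrite nth_take // ffunE (nth_sorted_counts _ k0) //.
have wpos : 0 < psi_weight p psi.
  rewrite psi_weightE (bigD1 r) //= ltr_pwDl //.
    by rewrite mulr_gt0 ?multiplicity_gt0 // prodr_gt0 // => k _; rewrite exprn_gt0.
  rewrite sumr_ge0 // => r' _; rewrite mulr_ge0 ?multiplicity_ge0 // prodr_ge0 // => k _.
  by rewrite exprn_ge0 // ltW.
rewrite /weight_of -(bigID (@mode_first K L ns) (fun f => injectiveb f)) /=.
rewrite (bigD1 psi) /=; last exact/injectiveP.
by rewrite ltr_pwDl // sumr_ge0 // => f _; exact: psi_weight_ge0.
Qed.

End Positivity.
End SortedCounts.

(** * Concentration of the empirical frequencies *)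

Section TypicalSamples.
Context {R : realType} {K : nat}.
Variable (q : 'I_K -> R).
Hypotheses (q_ge0 : forall k, 0 <= q k) (q_sum : \sum_k q k = 1).

Definition typical (e : R) (s : seq 'I_K) : bool :=
  [forall k : 'I_K, `|(count_mem k s)%:R - q k * (size s)%:R| <= e * (size s)%:R].

(** The deviations of the counts add up to 0, so a deficit at one label forces an excess at another,
    up to a factor [K]. Upper tail bounds are then enough. *)
Lemma atypical_excess e s : 0 < e -> ~~ typical e s ->
  exists k : 'I_K, (q k + e / K%:R) * (size s)%:R <= (count_mem k s)%:R.
Proof.
move=> e0; apply: contraPP => /forallNP H; apply/negP/negPn/forallP => k.
have K0 : (0 : R) < K%:R by rewrite ltr0n; apply: leq_ltn_trans (ltn_ord k).
have {}H j : (count_mem j s)%:R <= (q j + e / K%:R) * (size s)%:R.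
  by apply/ltW; rewrite ltNge; apply/negP/H.
have K1 : e / K%:R <= e.
  by rewrite ler_pdivrMr // ler_peMr ?(ltW e0) // ler1n -(ltr0n R).
have n0 : (0 : R) <= (size s)%:R by [].
rewrite ler_distl; apply/andP; split; last first.
  apply: le_trans (H k) _; rewrite -mulrDl; exact/ler_wpM2r/lerD.
have sumE : (size s)%:R = (count_mem k s)%:R + \sum_(j | j != k) (count_mem j s)%:R :> R.
  by rewrite -sum_count_mem natr_sum (bigD1 k).
have sumq : q k + \sum_(j | j != k) q j = 1 by rewrite -q_sum [in RHS](bigD1 k).
have : \sum_(j | j != k) (count_mem j s)%:R <=
    (\sum_(j | j != k) q j + e) * (size s)%:R.
  apply: (@le_trans _ _ (\sum_(j | j != k) (q j + e / K%:R) * (size s)%:R)).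
    by apply: ler_sum.
  rewrite -mulr_suml ler_wpM2r // big_split /= lerD2l sumr_const.
  rewrite -[leLHS]mulr_natr -[leRHS](@divfK _ K%:R) ?gt_eqF // ler_wpM2l ?divr_ge0 ?(ltW e0) // ler_nat.
  by rewrite -[leqRHS]card_ord max_card.
move: sumE sumq; set S := \sum_(j | _) (count_mem j s)%:R; set Q := \sum_(j | _) q j.
move=> sumE sumq; have -> : Q = 1 - q k by lra.
lra.
Qed.

Lemma atypical_prob e N : 0 < e -> e <= 1 -> exists (M rho : R),
  [/\ 0 <= M, 0 < rho < 1 &
    forall n, iid q n (fun s => (~~ ((N <= size s)%N && typical e s))%:R) <= M * rho ^+ n].
Proof.
move=> e0 e1; have K0 : (0 < K)%N.
  rewrite lt0n; apply/eqP => K0; move: q_sum.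
  rewrite big1; last by move=> k _; have := ltn_ord k; rewrite {2}K0.
  by move/eqP; rewrite eq_sym oner_eq0.
have K0' : (0 : R) < K%:R by rewrite ltr0n.
pose rho := expR (- ((e / K%:R) ^+ 2 / 8)).
have eK0 : 0 < e / K%:R by rewrite divr_gt0.
have eK1 : e / K%:R <= 1.
  by rewrite ler_pdivrMr // mul1r (le_trans e1) // ler1n.
have rho0 : 0 < rho by exact: expR_gt0.
have rho1 : rho < 1 by rewrite -expR0 ltr_expR oppr_lt0 divr_gt0 ?exprn_gt0.
(* The term [rho ^- N] makes the bound at least 1 for words shorter than [N], all of which are
   counted as bad; [K%:R] comes from the union bound over labels. *)
exists (rho ^- N + K%:R), rho; split; first by rewrite addr_ge0 ?invr_ge0 ?exprn_ge0 ?ltW.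
  by rewrite rho0.
move=> n; rewrite mulrDl.
case: (ltnP n N) => nN.
  apply: (@le_trans _ _ 1).
    rewrite -[leRHS](_ : iid q n (fun=> 1) = 1); last by rewrite iid_cst q_sum expr1n mulr1.
    by apply: le_iid => // s _; rewrite lern1 leq_b1.
  apply: (@le_trans _ _ (rho ^- N * rho ^+ n)); last first.
    by rewrite lerDl mulr_ge0 ?exprn_ge0 // ltW.
  rewrite mulrC ler_pdivlMr ?exprn_gt0 // mul1r.
  by apply: ler_wiXn2l; rewrite ?ltW // ltnW.
apply: (@le_trans _ _ (K%:R * rho ^+ n)); last first.
  by rewrite lerDr mulr_ge0 ?invr_ge0 ?exprn_ge0 ?(ltW rho0).
apply: (@le_trans _ _ (iid q n (fun s => \sum_(k : 'I_K)
    ((q k + e / K%:R) * n%:R <= (count_mem k s)%:R)%R%:R))).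
  apply: le_iid => // s sn; rewrite sn nN /=.
  case: (boolP (typical e s)) => [_|/(atypical_excess e s e0)[k]]; first by rewrite sumr_ge0.
  by rewrite sn => hk /=; rewrite (bigD1 k) //= hk lerDl sumr_ge0.
rewrite iid_sum; apply: (@le_trans _ _ (\sum_(k : 'I_K) rho ^+ n)).
  by apply: ler_sum => k _; exact: (iid_chernoff q q_ge0 q_sum n k _ eK0 eK1).
by rewrite sumr_const card_ord mulr_natl.
Qed.

(** Reduces the rate hypothesis on stopping times to an odds estimate [y] on typical samples: the
    constant [C] and the deviation of [ln y] each use up half of the allowed slack in the
    exponent. *)
Lemma typical_rate (g : seq 'I_K -> R) (D C B e0 : R) :
  0 < D -> 0 < C -> 0 <= B -> 0 < e0 ->
  (forall e, 0 < e -> e <= e0 -> exists N, forall s, (N <= size s)%N -> typical e s ->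
     exists y : R, [/\ 0 < y, y / (y + C) <= g s, g s <= C * y &
       `|ln y + (size s)%:R * D| <= B * e * (size s)%:R]) ->
  forall e : R, 0 < e ->
  exists (bad : pred (seq 'I_K)) (M rho : R),
    [/\ 0 <= M, 0 < rho < 1,
        forall n, iid q n (fun s => (bad s)%:R) <= M * rho ^+ n &
        forall s, (0 < size s)%N -> ~~ bad s ->
          expR (- ((size s)%:R * (D + e))) <= g s <= expR (- ((size s)%:R * (D - e)))].
Proof.
move=> D0 C0 B0 e00 H e ep.
(* Capping by [D] keeps [D - e' / 2] positive, so that [y <= 1] and the denominator [y + C] is at
   most [C + 1]. *)
pose e' := Num.min e D.
have e'0 : 0 < e' by rewrite lt_min ep D0.
have e'e : e' <= e by rewrite ge_min lexx.
have e'D : e' <= D by rewrite ge_min lexx orbT.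
pose h := Num.min (Num.min e0 1) (e' / (2 * (B + 1))).
have B1 : 0 < 2 * (B + 1) by lra.
have h0 : 0 < h by rewrite !lt_min e00 ltr01 divr_gt0.
have he0 : h <= e0 by rewrite !ge_min lexx.
have h1 : h <= 1 by rewrite !ge_min lexx orbT.
have hB : B * h <= e' / 2.
  have : h <= e' / (2 * (B + 1)) by rewrite !ge_min lexx orbT.
  rewrite ler_pdivlMr //; nra.
have [N0 HN0] := H h h0 he0.
(* From this length on, [ln (C + 1)] is at most [e' / 2] times the length. *)
pose N := maxn N0 (Num.trunc (2 * ln (C + 1) / e')).+1.
have [M [rho [M0 rho01 HM]]] := atypical_prob h N h0 h1.
exists (fun s => ~~ ((N <= size s)%N && typical h s)), M, rho; split => // s s0.
rewrite negbK => /andP[Ns ts].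
have [y [y0 gy1 gy2]] := HN0 s (leq_trans (leq_maxl _ _) Ns) ts.
set n : R := (size s)%:R; have n0 : 0 <= n by [].
rewrite ler_norml => /andP[ly1 ly2].
have Cn : ln (C + 1) <= n * (e' / 2).
  have : 2 * ln (C + 1) / e' <= n.
    apply/ltW/(lt_le_trans (truncnS_gt _)); rewrite ler_nat.
    exact: leq_trans (leq_maxr _ _) Ns.
  rewrite ler_pdivrMr //; lra.
have C1 : C + 1 <= expR (n * (e' / 2)).
  by rewrite -[leLHS]lnK ?posrE ?ler_expR //; lra.
have yE : y = expR (ln y) by rewrite lnK ?posrE.
have Bn : B * h * n <= e' / 2 * n by exact: ler_wpM2r.
have y_lo : expR (- (n * (D + e' / 2))) <= y by rewrite [leRHS]yE ler_expR; lra.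
have y_hi : y <= expR (- (n * (D - e' / 2))) by rewrite [leLHS]yE ler_expR; lra.
have y1 : y <= 1.
  apply: le_trans y_hi _; rewrite -[leRHS]expR0 ler_expR oppr_le0 mulr_ge0 //; lra.
apply/andP; split.
  apply: le_trans gy1; rewrite ler_pdivlMr; last by lra.
  apply: le_trans y_lo.
  apply: (@le_trans _ _ (expR (- (n * (D + e))) * expR (n * (e' / 2)))).
    rewrite ler_wpM2l ?expR_ge0 //; lra.
  rewrite -expRD ler_expR.
  have : n * e' <= n * e by exact: ler_wpM2l.
  lra.
apply: (le_trans gy2).
apply: (@le_trans _ _ (expR (n * (e' / 2)) * expR (- (n * (D - e' / 2))))).
  apply: ler_pM => //; lra.
rewrite -expRD ler_expR.
have : n * e' <= n * e by exact: ler_wpM2l.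
lra.
Qed.

End TypicalSamples.

(** * The truncated multinomial sum as an integral over words *)

Lemma iid_absent {R : realType} {T : finType} (q : T -> R) (k : T) n : q k = 0 ->
  iid q n (fun s => (0 < count_mem k s)%N%:R) = 0.
Proof.
move=> qk; elim: n => [|n IH] //=; apply: big1 => x _.
case: (eqVneq x k) => [->|_]; first by rewrite qk mul0r.
by rewrite IH mulr0.
Qed.

Section Remainder.
Context {R : realType} {K L : nat} {p : nat -> R} {ns : seq nat}.
Hypothesis p_gt0 : forall k : 'I_K, 0 < p k.
Variable psi : {ffun 'I_(Ln L ns) -> 'I_K}.
Local Notation N := (nbar L ns).
Local Notation remainder := {ffun 'I_K -> 'I_(vd L ns).+1}.

(** Weight 0 on the assigned labels lets words range over the whole alphabet while only the free
    labels contribute. *)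
Let qJ (j : 'I_K) : R := if inJ psi j then p j else 0.
Let mass : R := \sum_(j : 'I_K | inJ psi j) p j.

Lemma qJ_ge0 j : 0 <= qJ j.
Proof. by rewrite /qJ; case: ifP => // _; rewrite ltW. Qed.

Lemma qJ_sum : \sum_j qJ j = mass.
Proof. by rewrite /mass [RHS]big_mkcond. Qed.

Lemma multinomial_term (r : remainder) : admissible psi r ->
  (N`!)%:R / \prod_(j | inJ psi j) ((nat_of_ord (r j))`!)%:R
    * \prod_(j | inJ psi j) p j ^+ r j =
  iid qJ N (fun s => [forall j, count_mem j s == r j]%:R).
Proof.
move=> /andP[/forallP r0 /eqP rN].
have {}r0 j : ~~ inJ psi j -> nat_of_ord (r j) = 0%N by move=> jJ; have := r0 j; rewrite jJ => /eqP.
rewrite iid_multinomial; last first.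
  by rewrite (bigID (inJ psi)) /= rN big1 ?addn0.
congr (_ / _ * _).
  rewrite [RHS](bigID (inJ psi)) /= [X in _ * X]big1 ?mulr1 // => j /r0 ->; by rewrite fact0.
rewrite [RHS](bigID (inJ psi)) /= [X in _ * X]big1 ?mulr1 // => [|j /r0 ->]; last by rewrite expr0.
by apply: eq_bigr => j jJ; rewrite /qJ jJ.
Qed.

Lemma StildeE : Stilde p psi =
  iid qJ N (fun s => \sum_(r : remainder | admissible psi r)
    wr R psi r * [forall j, count_mem j s == r j]%:R).
Proof.
rewrite iid_sum; apply: eq_bigr => r adm.
by rewrite -mulrA multinomial_term // iidZ.
Qed.

Lemma wr_ge0 (r : remainder) : 0 <= wr R psi r.
Proof. by rewrite invr_ge0. Qed.

Lemma wr_le1 (r : remainder) : wr R psi r <= 1.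
Proof. by rewrite invf_le1 ?ltr0n ?ler1n ?bin_gt0 ?leq_addr. Qed.

(** A word has a single vector of counts, so at most one term of the inner sum is nonzero, and it is
    at most 1. *)
Lemma Stilde_le : Stilde p psi <= mass ^+ N.
Proof.
rewrite StildeE -[leRHS]mul1r -qJ_sum -iid_cst; apply: le_iid; first exact: qJ_ge0.
move=> s _; case: (pickP (fun r : remainder =>
    admissible psi r && [forall j, count_mem j s == r j])) => [r0 /andP[a0 h0]|none].
  rewrite (bigD1 r0) //= h0 mulr1 big1 ?addr0 ?wr_le1 // => r /andP[_ rr0].
  case: (boolP [forall j, _]) => [h|_]; last by rewrite mulr0.
  case/eqP: rr0; apply/ffunP => j; apply/val_inj => /=.
  by move/forallP/(_ j)/eqP: h => <-; move/forallP/(_ j)/eqP: h0 => <-.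
by rewrite big1 // => r adm; have := none r; rewrite adm /= => ->; rewrite mulr0.
Qed.

(** A word of free labels in which none occurs more than [vd] times contributes at least [w]. Under
    the normalized weight, Chernoff and a union bound give such words probability at least one
    half. *)
Lemma Stilde_ge (w eta : R) : 0 < w -> 0 < mass -> 0 < eta -> eta <= 1 ->
  (forall r : remainder, w <= wr R psi r) ->
  (forall j, inJ psi j -> (p j / mass + eta) * N%:R <= (vd L ns)%:R) ->
  K%:R * expR (- (eta ^+ 2 / 8)) ^+ N <= 1 / 2 ->
  w / 2 * mass ^+ N <= Stilde p psi.
Proof.
move=> w0 m0 eta0 eta1 ww Hvd HK.
pose q' j := mass^-1 * qJ j.
have q'0 j : 0 <= q' j by rewrite mulr_ge0 ?qJ_ge0 // invr_ge0 ltW.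
have q'1 : \sum_j q' j = 1 by rewrite -mulr_sumr qJ_sum mulVf // gt_eqF.
pose excess s j : R := if inJ psi j then (vd L ns < count_mem j s)%N%:R
                       else (0 < count_mem j s)%N%:R.
have iidE F : iid qJ N F = mass ^+ N * iid q' N F.
  by rewrite iidZw mulrA -exprMn divff ?gt_eqF // expr1n mul1r.
rewrite StildeE iidE mulrC ler_wpM2l ?exprn_ge0 ?(ltW m0) //.
(* The indicator of no excess is at least one minus the number of labels in excess; an assigned
   label is in excess as soon as it occurs. *)
apply: (@le_trans _ _ (iid q' N (fun s => w * (1 + -1 * \sum_j excess s j)))); last first.
  apply: le_iid => // s sN.
  case: (boolP [forall j, (count_mem j s <= if inJ psi j then vd L ns else 0)%N]) => H.
    pose r0 : remainder := [ffun j => inord (count_mem j s)].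
    have r0E j : nat_of_ord (r0 j) = count_mem j s.
      rewrite ffunE inordK // ltnS; move/forallP/(_ j): H; case: ifP => // _.
      by rewrite leqn0 => /eqP ->.
    have a0 : admissible psi r0.
      have r00 j : ~~ inJ psi j -> nat_of_ord (r0 j) = 0%N.
        rewrite r0E => /negbTE jJ; move/forallP/(_ j): H; rewrite jJ leqn0; by move/eqP.
      apply/andP; split; first by apply/forallP => j; apply/implyP => /r00 ->.
      rewrite -sN -sum_count_mem [X in _ == X](bigID (inJ psi)) /=.
      rewrite [X in _ == (_ + X)%N]big1 => [|j jJ]; last by rewrite -r0E r00.
      by rewrite addn0; apply/eqP/eq_bigr => j _; rewrite r0E.
    have ex0 : 0 <= \sum_j excess s j.
      by rewrite sumr_ge0 // => j _; rewrite /excess; case: ifP.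
    rewrite (bigD1 r0) //=; have -> : [forall j, count_mem j s == r0 j].
      by apply/forallP => j; rewrite r0E.
    rewrite mulr1; apply: (@le_trans _ _ w).
      by rewrite -[leRHS]mulr1 ler_wpM2l ?(ltW w0) //; lra.
    rewrite (le_trans (ww r0)) // lerDl sumr_ge0 // => r _.
    by rewrite mulr_ge0 ?wr_ge0.
  apply: (@le_trans _ _ 0); last by rewrite sumr_ge0 // => r _; rewrite mulr_ge0 ?wr_ge0.
  rewrite pmulr_rle0 // mulN1r subr_le0.
  move/forallPn: H => [j]; rewrite -ltnNge => hj.
  rewrite (bigD1 j) //= {1}/excess; move: hj; case: (inJ psi j) => -> /=; rewrite lerDl sumr_ge0 // => i _;
    by rewrite /excess; case: ifP.
rewrite iidZ ler_wpM2l ?(ltW w0) // iidD iid_cst q'1 expr1n mulr1 iidZ mulN1r iid_sum.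
suff : \sum_j iid q' N (fun s => excess s j) <= 1 / 2 by lra.
apply: le_trans HK; apply: (@le_trans _ _ (\sum_(j : 'I_K) expR (- (eta ^+ 2 / 8)) ^+ N)).
  apply: ler_sum => j _; rewrite /excess; case jJ: (inJ psi j); last first.
    by rewrite iid_absent ?exprn_ge0 ?expR_ge0 // /q' /qJ jJ mulr0.
  apply: le_trans (iid_chernoff q' q'0 q'1 N j eta eta0 eta1); apply: le_iid => // s _.
  case: ltnP => //= h; rewrite ler_nat lt0b; apply: le_trans (_ : (vd L ns)%:R <= _).
    by rewrite /q' /qJ jJ [mass^-1 * _]mulrC Hvd.
  by rewrite ler_nat ltnW.
by rewrite sumr_const card_ord mulr_natl.
Qed.

End Remainder.

(** * The case [L = 2], with a single listed count *)

(** The last hypothesis says that [v] is at most [m / (m + n)], the maximizer of the expression.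
    Instead of a derivative, [z <= expr (z - 1)] is applied to [u / v] and [(1 - u) / (1 - v)],
    written with [expR]. *)
Lemma expr_mono_beta {R : realType} (u v : R) (m n : nat) :
  0 < u -> u <= v -> v < 1 -> n%:R * v <= m%:R * (1 - v) ->
  u ^+ m * (1 - u) ^+ n <= v ^+ m * (1 - v) ^+ n.
Proof.
move=> u0 uv v1 H; have v0 : 0 < v by lra.
have v1' : 0 < 1 - v by lra.
have u1' : 0 < 1 - u by lra.
have le_exp (z : R) : z <= expR (z - 1) by have := expR_ge1Dx (z - 1); lra.
have ratio_le1 : (u / v) ^+ m * ((1 - u) / (1 - v)) ^+ n <= 1.
  apply: (@le_trans _ _ (expR (u / v - 1) ^+ m * expR ((1 - u) / (1 - v) - 1) ^+ n)).
    have uv0 : 0 <= u / v by rewrite divr_ge0 ?(ltW v0) ?(ltW u0).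
    have uv1 : 0 <= (1 - u) / (1 - v) by rewrite divr_ge0 ?(ltW v1') ?(ltW u1').
    apply: ler_pM; rewrite ?exprn_ge0 //;
      by apply: lerXn2r; rewrite ?nnegrE ?expR_ge0.
  rewrite -!expRM_natl -expRD -[leRHS]expR0 ler_expR.
  have -> : u / v - 1 = - ((v - u) * (1 - v) / (v * (1 - v))) by field; rewrite !gt_eqF.
  have -> : (1 - u) / (1 - v) - 1 = (v - u) * v / (v * (1 - v)) by field; rewrite !gt_eqF.
  rewrite mulrN addrC subr_le0 !mulrA ler_wpM2r ?invr_ge0 ?mulr_ge0 ?(ltW v0) ?(ltW v1') //.
  have : (v - u) * (n%:R * v) <= (v - u) * (m%:R * (1 - v)) by apply: ler_wpM2l => //; lra.
  lra.
have -> : u ^+ m * (1 - u) ^+ n =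
    (u / v) ^+ m * ((1 - u) / (1 - v)) ^+ n * (v ^+ m * (1 - v) ^+ n).
  by rewrite !expr_div_n; field; rewrite !expf_neq0 ?gt_eqF.
by rewrite ler_piMl // mulr_ge0 ?exprn_ge0 ?ltW.
Qed.

Section SingleTopCount.
Context {R : realType} {K : nat} {p : nat -> R} {ns : seq nat}.
Variables l0 l1 : 'I_K.
Hypotheses (l0E : nat_of_ord l0 = 0%N) (l1E : nat_of_ord l1 = 1%N).
Hypothesis p_gt0 : forall k : 'I_K, 0 < p k.
Hypothesis p_le1 : forall k : 'I_K, k != l0 -> p k <= p l1.
Hypothesis p_lt0 : p l1 < p l0.
Hypothesis p_sum : \sum_(k : 'I_K) p k = 1.
Hypothesis ns_size : (0 < size ns)%N.

Local Notation n0 := (nth 0%N ns 0).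
Local Notation N := (nbar 2 ns).
Local Notation assignment := {ffun 'I_(Ln 2 ns) -> 'I_K}.

Lemma Ln2E : Ln 2 ns = 1%N.
Proof. exact/minn_idPl. Qed.

Lemma vd2E : vd 2 ns = n0.
Proof. by rewrite /vd Ln2E. Qed.

Lemma cd2E : cd 2 ns = 1%N.
Proof. by rewrite /cd vd2E Ln2E; case: ns ns_size => // a s _ /=; rewrite take0 /= eqxx. Qed.

Lemma nbar2E : N = (sumn ns - n0)%N.
Proof. by rewrite /nbar Ln2E; case: ns ns_size => // a s _ /=; rewrite take0 /= addn0. Qed.

Let i0 : 'I_(Ln 2 ns) := cast_ord (esym Ln2E) ord0.

Lemma i0E : nat_of_ord i0 = 0%N. Proof. by []. Qed.

(** With one listed rank, an assignment is just the label placed there. *)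
Definition only (a : 'I_K) : assignment := [ffun => a].

Lemma ord_Ln2 (i : 'I_(Ln 2 ns)) : i = i0.
Proof. by apply/val_inj => /=; have := ltn_ord i; rewrite {2}Ln2E ltnS leqn0 => /eqP. Qed.

Lemma inJ_only a j : inJ (only a) j = (j != a).
Proof.
rewrite /inJ; congr (~~ _); apply/codomP/eqP => [[i ->]|->]; first by rewrite ffunE.
by exists i0; rewrite ffunE.
Qed.

Lemma mass_only a : \sum_(j : 'I_K | inJ (only a) j) p j = 1 - p a.
Proof.
rewrite -p_sum [in RHS](bigD1 a) //= [RHS]addrC addKr.
by apply: eq_bigl => j; rewrite inJ_only.
Qed.

Lemma weight_of_only a :
  weight_of (p := p) (fun psi : assignment => psi i0 == a) = p a ^+ n0 * Stilde p (only a).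
Proof.
rewrite /weight_of (big_pred1 (only a)); last first.
  move=> psi; apply/andP/eqP => [[_ /eqP h]|->].
    by apply/ffunP => i; rewrite ffunE (ord_Ln2 i).
  rewrite ffunE eqxx; split => //; apply/injectiveP => i j _.
  by rewrite (ord_Ln2 i) (ord_Ln2 j).
rewrite /psi_weight; congr (_ * _); rewrite (big_pred1 i0) ?ffunE //.
by move=> i; rewrite (ord_Ln2 i) /= eqxx.
Qed.

Lemma p_lt1 (k : 'I_K) : p k < 1.
Proof.
have [j jk] : exists j : 'I_K, j != k.
  case: (eqVneq l0 k) => [<-|h]; last by exists l0.
  by exists l1; apply/eqP => /(congr1 val) /=; rewrite l0E l1E.
rewrite -p_sum (bigD1 k) //= (bigD1 j) //= ltrDl ltr_pwDl // sumr_ge0 // => i _.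
exact: ltW.
Qed.

Lemma weight_of_only_le (a : 'I_K) :
  weight_of (p := p) (fun psi : assignment => psi i0 == a) <= p a ^+ n0 * (1 - p a) ^+ N.
Proof.
rewrite weight_of_only ler_wpM2l ?exprn_ge0 ?(ltW (p_gt0 _)) //.
by apply: le_trans (Stilde_le p_gt0 _) _; rewrite mass_only.
Qed.

(** The tie weight is the inverse of one plus the number of ties, as [cd] is 1, hence at least
    [K.+1%:R^-1]; the factor 2 is the probability lost to truncation. *)
Lemma weight_of_only_ge (a : 'I_K) (eta : R) : 0 < eta -> eta <= 1 ->
  (forall j : 'I_K, j != a -> (p j / (1 - p a) + eta) * N%:R <= n0%:R) ->
  K%:R * expR (- (eta ^+ 2 / 8)) ^+ N <= 1 / 2 ->
  p a ^+ n0 * (1 - p a) ^+ N <=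
    2 * K.+1%:R * weight_of (p := p) (fun psi : assignment => psi i0 == a).
Proof.
move=> eta0 eta1 H HK; rewrite weight_of_only mulrCA.
rewrite ler_wpM2l ?exprn_ge0 ?(ltW (p_gt0 _)) //.
have K0 : (0 : R) < K.+1%:R by [].
have := @Stilde_ge R K 2 p ns p_gt0 (only a) (K.+1%:R^-1) eta.
rewrite mass_only subr_gt0 p_lt1 invr_gt0 => /(_ K0 isT eta0 eta1).
have hw r : K.+1%:R^-1 <= wr R (only a) r.
  rewrite /wr cd2E bin1 lef_pV2 ?posrE // ler_nat ltnS -[leqRHS]card_ord; exact: max_card.
move=> /(_ hw); have HJ j : inJ (only a) j -> (p j / (1 - p a) + eta) * N%:R <= (vd 2 ns)%:R.
  by rewrite inJ_only vd2E => /H.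
move=> /(_ HJ HK) h.
have K00 : K.+1%:R != 0 :> R by rewrite gt_eqF.
have -> : (1 - p a) ^+ N = 2 * K.+1%:R * (K.+1%:R^-1 / 2 * (1 - p a) ^+ N) by field.
by rewrite ler_wpM2l // mulr_ge0.
Qed.

(** Likelihood ratio of the Bernoulli laws of parameters [p l1] and [p l0] for [n0] successes and
    [N] failures. *)
Let y := (p l1 / p l0) ^+ n0 * ((1 - p l1) / (1 - p l0)) ^+ N.

Lemma odds_ratioE : p l1 ^+ n0 * (1 - p l1) ^+ N = y * (p l0 ^+ n0 * (1 - p l0) ^+ N).
Proof.
have pl0 : p l0 != 0 by rewrite gt_eqF.
have pl1 : 1 - p l0 != 0 by rewrite gt_eqF // subr_gt0 p_lt1.
by rewrite /y !expr_div_n; field; rewrite !expf_neq0.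
Qed.

Lemma odds_ratio_gt0 : 0 < y.
Proof. by rewrite mulr_gt0 ?exprn_gt0 ?divr_gt0 ?subr_gt0 ?p_lt1. Qed.

(** Lower bounds on weights are needed only for [l0] and [l1]. Every other first label is dominated
    by [l1] through [expr_mono_beta], since [p l1] is at most the top frequency. *)
Lemma agg_error_two (eta : R) : 0 < eta -> eta <= 1 ->
  (forall j : 'I_K, j != l0 -> (p j / (1 - p l0) + eta) * N%:R <= n0%:R) ->
  (forall j : 'I_K, j != l1 -> (p j / (1 - p l1) + eta) * N%:R <= n0%:R) ->
  K%:R * expR (- (eta ^+ 2 / 8)) ^+ N <= 1 / 2 ->
  N%:R * p l1 <= n0%:R * (1 - p l1) ->
  0 < weight_of (p := p) (@mode_first K 2 ns) + weight_of (p := p) (predC (@mode_first K 2 ns)) ->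
  y / (y + 2 * K.+1%:R * K%:R) <= 1 - agg_posterior K 2 p ns <= 2 * K.+1%:R * K%:R * y.
Proof.
move=> eta0 eta1 H0 H1 HK Hp Hpos.
have mE : weight_of (p := p) (@mode_first K 2 ns) =
    weight_of (p := p) (fun psi : assignment => psi i0 == l0).
  by apply: eq_weight_of; exact: (mode_firstE _ l0E _ i0E).
have A_le := weight_of_only_le l0; have A_ge := weight_of_only_ge l0 _ eta0 eta1 H0 HK.
have B_ge := weight_of_only_ge l1 _ eta0 eta1 H1 HK.
have BE := weight_of_other _ l0E _ i0E : weight_of (p := p) _ = _.
have l10 : l1 != l0 by exact: neq_l01.
have y0 := odds_ratio_gt0.
have W0 (P : pred assignment) : 0 <= weight_of (p := p) P by exact: (weight_of_ge0 p_gt0).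
have K1 : (1 : R) <= K%:R by rewrite ler1n; apply: leq_ltn_trans (ltn_ord l0).
have KS : (0 : R) < K.+1%:R by [].
have pp0 : 0 <= p l1 ^+ n0 * (1 - p l1) ^+ N.
  by rewrite mulr_ge0 ?exprn_ge0 ?subr_ge0 ?ltW ?p_lt1.
apply/andP; split.
  apply: agg_error_ge => //.
  rewrite mE; apply: (@le_trans _ _ (y * (p l0 ^+ n0 * (1 - p l0) ^+ N))).
    by rewrite ler_wpM2l // ltW.
  rewrite -odds_ratioE; apply: (le_trans B_ge); rewrite -[leRHS]mulrA.
  rewrite ler_wpM2l ?mulr_ge0 //; apply: (@le_trans _ _ (weight_of (p := p) (predC (@mode_first K 2 ns)))).
    by rewrite BE (bigD1 l1) //= lerDl sumr_ge0.
  by rewrite ler_peMl.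
apply: agg_error_le => //; first by rewrite mulr_ge0 ?(ltW y0).
rewrite mE.
apply: (@le_trans _ _ (K%:R * (p l1 ^+ n0 * (1 - p l1) ^+ N))).
  rewrite BE; apply: (@le_trans _ _ (\sum_(a : 'I_K | a != l0) p l1 ^+ n0 * (1 - p l1) ^+ N)).
    apply: ler_sum => a al; apply: le_trans (weight_of_only_le a) _.
    by apply: expr_mono_beta => //; rewrite ?p_le1 ?p_lt1.
  rewrite sumr_const -[leLHS]mulr_natl ler_wpM2r // ler_nat -[leqRHS]card_ord; exact: max_card.
rewrite odds_ratioE; have -> : forall w : R, 2 * K.+1%:R * K%:R * y * w = K%:R * (y * (2 * K.+1%:R * w)).
  by move=> w; ring.
by rewrite ler_wpM2l // ler_wpM2l // ltW.
Qed.

End SingleTopCount.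

(** * Identification of the two rates *)

Section Rates.
Context {R : realType} {K : nat} {p : nat -> R}.
Variables l0 l1 : 'I_K.
Hypotheses (l0E : nat_of_ord l0 = 0%N) (l1E : nat_of_ord l1 = 1%N).
Hypothesis p_gt0 : forall k : 'I_K, 0 < p k.
Hypothesis p_le1 : forall k : 'I_K, k != l0 -> p k <= p l1.
Hypothesis p_lt0 : p l1 < p l0.
Hypothesis p_sum : \sum_(k : 'I_K) p k = 1.

Local Notation q := (fun k : 'I_K => p k).
Local Notation l := (ln (p l0 / p l1)).

Let error L (s : seq 'I_K) : R := 1 - posterior_of L p s.

Lemma first_index L (s : seq 'I_K) : (1 < L)%N -> (0 < size s)%N ->
  (0 < Ln L (sorted_counts s))%N.
Proof.
move=> L1 /size_sorted_counts_gt0 s0; rewrite /Ln; lia.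
Qed.

(** The crude exchange gives an error of at least [x ^+ m / (x ^+ m + 1)] with [m] at most the
    sample size; halving the base absorbs the denominator, which is at most 2. *)
Lemma error_ge L s : (1 < L)%N -> (0 < size s)%N ->
  (p l1 / p l0 / 2) ^+ size s <= error L s.
Proof.
move=> L1 s0; set x := p l1 / p l0; set ns := sorted_counts s.
have x0 : 0 < x by rewrite divr_gt0.
have x1 : x <= 1 by rewrite ler_pdivrMr // mul1r ltW.
pose i0 := Ordinal (first_index L s L1 s0).
have ns_sorted := sorted_counts_nth_le s.
have n0s : (nth 0 ns 0 <= size s)%N.
  rewrite -(sumn_sorted_counts s) /ns; case: (sorted_counts s) => //= a t.
  exact: leq_addr.
have h : x ^+ nth 0%N ns 0 * weight_of (p := p) (@mode_first K L ns) <=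
    1 * weight_of (p := p) (predC (@mode_first K L ns)).
  rewrite mul1r; exact: (weight_mode_le_crude _ _ l0E l1E p_gt0 (ltW p_lt0) ns_sorted i0 erefl).
apply: le_trans (agg_error_ge p_gt0 _ _ (exprn_gt0 _ x0) ler01 h).
set m := nth 0%N ns 0 in n0s *.
have xm1 : x ^+ m <= 1 by rewrite exprn_ile1 // ltW.
have xm0 : 0 < x ^+ m by rewrite exprn_gt0.
rewrite ler_pdivlMr; last by lra.
apply: (@le_trans _ _ ((x / 2) ^+ size s * 2)).
  apply: ler_wpM2l; first by apply: exprn_ge0; lra.
  lra.
have -> : (x / 2) ^+ size s * 2 = x ^+ size s / 2 ^+ (size s).-1.
  by rewrite -{1 2}(prednK s0); move: (size s).-1 => n; rewrite expr_div_n [2 ^+ n.+1]exprS /=; field; rewrite expf_neq0.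
rewrite ler_pdivrMr ?exprn_gt0 //; apply: (@le_trans _ _ (x ^+ m)).
  by apply: ler_wiXn2l => //; exact: ltW.
by rewrite ler_peMr ?exprn_ege1 ?(ltW xm0) // ler1n.
Qed.

Lemma survival_surv L (d : R) n :
  survival K L p d n = surv q (error L) d n.
Proof.
rewrite /survival /seq_prob (sum_tuple_iid q n (fun s =>
  [forall m : 'I_n, (posterior_of L p (take m.+1 s) < 1 - d)%R])).
apply: eq_iid => s _; congr ((_ : bool)%:R); apply: eq_forallb => m.
by rewrite /error ltrBrDr addrC -ltrBrDr.
Qed.

Lemma q_ge0 (k : 'I_K) : 0 <= q k. Proof. exact: ltW. Qed.

Lemma expected_stop_cvg L (D C B e0 : R) : (1 < L)%N ->
  0 < D -> 0 < C -> 0 <= B -> 0 < e0 ->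
  (forall e, 0 < e -> e <= e0 -> exists N, forall s, (N <= size s)%N -> typical q e s ->
     exists y : R, [/\ 0 < y, y / (y + C) <= error L s, error L s <= C * y &
       `|ln y + (size s)%:R * D| <= B * e * (size s)%:R]) ->
  (fun d : R => (expected_stop K L p d * ((ln d^-1)^-1)%:E)%E) @ 0^'+ --> (D^-1)%:E.
Proof.
move=> L1 D0 C0 B0 e00 H.
have rate := typical_rate q q_ge0 p_sum (error L) D C B e0 D0 C0 B0 e00 H.
have c0 : 0 < p l1 / p l0 / 2 by rewrite !divr_gt0.
have c1 : p l1 / p l0 / 2 <= 1.
  have : p l1 / p l0 <= 1 by rewrite ler_pdivrMr // mul1r ltW.
  have : 0 < p l1 / p l0 by rewrite divr_gt0.
  lra.
have gge s : (0 < size s)%N -> (p l1 / p l0 / 2) ^+ size s <= error L s by exact: error_ge.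
have := stopping_time_cvg q q_ge0 p_sum (error L) D _ D0 c0 c1 gge rate.
apply: cvg_trans; apply: near_eq_cvg; near=> d; congr (_ * _)%E.
by apply: eq_eseriesr => n _; rewrite survival_surv.
Unshelve. all: by end_near. Qed.

Lemma typical_counts e s (k : 'I_K) : typical q e s ->
  (p k - e) * (size s)%:R <= (count_mem k s)%:R <= (p k + e) * (size s)%:R.
Proof.
by move=> /forallP /(_ k); rewrite ler_distl mulrBl mulrDl.
Qed.

(** The first bound on [e] makes [l0] the strict winner; the second ensures that [l1] has been seen,
    so that there is a second count. *)
Lemma typical_top e s : (0 < size s)%N -> typical q e s ->
  e <= (p l0 - p l1) / 4 -> e <= p l1 / 2 ->
  [/\ nth 0%N (sorted_counts s) 0 = count_mem l0 s, (1 < size (sorted_counts s))%N &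
      (p l1 - e) * (size s)%:R <= (nth 0%N (sorted_counts s) 1)%:R <= (p l1 + e) * (size s)%:R].
Proof.
move=> s0 ts e1 e2; have n0 : (0 : R) < (size s)%:R by rewrite ltr0n.
have p10 := p_lt0; have p1 := p_gt0 l1.
have l10 := neq_l01 _ _ l0E l1E.
have [||h0 h1 h2 [k kl hk]] := top_two_counts s l0 l1 l10.
- rewrite -(ltr0n R); have /andP[h _] := typical_counts e s l1 ts.
  by apply: lt_le_trans h; rewrite mulr_gt0 //; lra.
- move=> k kl; rewrite -(ltr_nat R).
  have /andP[_ hk] := typical_counts e s k ts; have /andP[h0 _] := typical_counts e s l0 ts.
  apply: (le_lt_trans hk); apply: lt_le_trans h0; rewrite ltr_pM2r //.
  have := p_le1 k kl; lra.
split => //; apply/andP; split.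
  have /andP[h _] := typical_counts e s l1 ts; apply: (le_trans h); by rewrite ler_nat.
rewrite hk; have /andP[_ h] := typical_counts e s k ts; apply: (le_trans h).
by rewrite ler_wpM2r // lerD2r p_le1.
Qed.

Lemma log_ratio_gt0 : 0 < l.
Proof. by rewrite ln_gt0 // ltr_pdivlMr // mul1r. Qed.

Lemma ln_ratioN : ln (p l1 / p l0) = - l.
Proof. by rewrite -lnV ?posrE ?divr_gt0 // invf_div. Qed.

Lemma expected_stop_many_cvg L : (2 < L)%N -> (L <= K)%N ->
  (fun d : R => (expected_stop K L p d * ((ln d^-1)^-1)%:E)%E) @ 0^'+
    --> (((p l0 - p l1) * l)^-1)%:E.
Proof.
move=> L2 LK; have lgt := log_ratio_gt0; have p10 := p_lt0; have p1 := p_gt0 l1.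
have K0 : (0 : R) < K%:R by rewrite ltr0n; apply: leq_ltn_trans (ltn_ord l0).
(* The constant [2 * l] arises because [n0] and [n1] each deviate from their means by at most [e]
   times the sample size. *)
apply: (@expected_stop_cvg L _ K%:R (2 * l) (Num.min ((p l0 - p l1) / 4) (p l1 / 2))) => //.
- exact: ltnW.
- by rewrite mulr_gt0 ?subr_gt0.
- by rewrite mulr_ge0 // ltW.
- by rewrite lt_min !divr_gt0 // subr_gt0.
move=> e e0; rewrite le_min => /andP[e1 e2]; exists 1%N => s s0 ts.
have [h0 h1 /andP[h2 h3]] := typical_top e s s0 ts e1 e2.
have Ln1 : (1 < Ln L (sorted_counts s))%N by rewrite /Ln; lia.
pose i0 := Ordinal (ltnW Ln1).
set ns := sorted_counts s in h0 h1 h2 h3 *.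
have ns_sorted : forall i j, (i <= j)%N -> (nth 0 ns j <= nth 0 ns i)%N := sorted_counts_nth_le s.
pose y := (p l1 / p l0) ^+ (nth 0%N ns 0 - nth 0%N ns 1).
have y0 : 0 < y by rewrite exprn_gt0 // divr_gt0.
exists y; split => //.
- apply: agg_error_ge => //.
  exact: (weight_mode_le _ _ l0E l1E p_gt0 p_le1 (ltW p_lt0) ns_sorted i0 erefl Ln1).
- apply: agg_error_le => //; [by rewrite mulr_ge0 // ltW| |exact: total_weight_gt0].
  exact: (weight_other_le _ _ l0E p_gt0 p_le1 (ltW p_lt0) ns_sorted i0 erefl Ln1).
have yl : ln y = - l * ((nth 0%N ns 0)%:R - (nth 0%N ns 1)%:R).
  by rewrite lnXn ?divr_gt0 // ln_ratioN -[LHS]mulr_natr natrB ?ns_sorted.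
have /andP[h4 h5] := typical_counts e s l0 ts.
rewrite yl h0; set a : R := (count_mem l0 s)%:R in h4 h5 *.
set b : R := (nth 0%N ns 1)%:R in h2 h3 *; set n : R := (size s)%:R in h2 h3 h4 h5 *.
have -> : - l * (a - b) + n * ((p l0 - p l1) * l) = l * (n * (p l0 - p l1) - (a - b)) by ring.
have -> : 2 * l * e * n = l * (2 * e * n) by ring.
rewrite normrM gtr0_norm // ler_wpM2l ?(ltW lgt) // ler_norml; apply/andP; split; lra.
Qed.

(** Gibbs inequality from [1 + z <= expR z], used at minus each log ratio and averaged with weights
    [p l0] and [1 - p l0]; the first use is strict because [l] is nonzero. *)
Lemma KL_bern_gt0 : 0 < KL_bern (p l0) (p l1).
Proof.
have h0 := p_lt1 l0 l1 l0E l1E p_gt0 p_sum l0; have h1 := p_lt1 l0 l1 l0E l1E p_gt0 p_sum l1.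
have p0 := p_gt0 l0.
have a1 : 1 - l < p l1 / p l0.
  rewrite -[ltRHS]lnK ?posrE ?divr_gt0 // ln_ratioN; apply: expR_gt1Dx.
  by rewrite oppr_eq0 gt_eqF // log_ratio_gt0.
have a2 : 1 - ln ((1 - p l0) / (1 - p l1)) <= (1 - p l1) / (1 - p l0).
  have -> : (1 - p l1) / (1 - p l0) = expR (- ln ((1 - p l0) / (1 - p l1))).
    by rewrite expRN lnK ?invf_div // posrE divr_gt0 ?subr_gt0.
  exact: expR_ge1Dx.
have {}a1 : p l0 * (1 - l) < p l1.
  by move: a1; rewrite ltr_pdivlMr // mulrC.
have {}a2 : (1 - p l0) * (1 - ln ((1 - p l0) / (1 - p l1))) <= 1 - p l1.
  by move: a2; rewrite ler_pdivlMr ?subr_gt0 // mulrC.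
rewrite /KL_bern; lra.
Qed.

Lemma expected_stop_two_cvg :
  (fun d : R => (expected_stop K 2 p d * ((ln d^-1)^-1)%:E)%E) @ 0^'+
    --> ((KL_bern (p l0) (p l1))^-1)%:E.
Proof.
have lgt := log_ratio_gt0; have p10 := p_lt0; have p1 := p_gt0 l1; have p0 := p_gt0 l0.
have p_lt1' := p_lt1 l0 l1 l0E l1E p_gt0 p_sum.
have p0_1 := p_lt1' l0; have p1_1 := p_lt1' l1.
have K0 : (0 : R) < K%:R by rewrite ltr0n; apply: leq_ltn_trans (ltn_ord l0).
have l10 := neq_l01 _ _ l0E l1E.
pose mu := ln ((1 - p l1) / (1 - p l0)).
have mu0 : 0 < mu by rewrite ln_gt0 // ltr_pdivlMr ?subr_gt0 // mul1r; lra.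
(* Margin by which the top count exceeds, per sample, the expected count of any free label: [p j /
   (1 - p b) * (1 - p l0) <= p l0 - gam] for [b] equal to [l0] or [l1] and [j != b]. The extreme
   case is [b = l1], [j = l0], where the gap is [gam / (1 - p l1)]. *)
pose gam := p l0 * (p l0 - p l1).
have gam0 : 0 < gam by rewrite mulr_gt0 // subr_gt0.
have gam1 : gam <= p l0 - p l1 by rewrite ler_piMl ?subr_ge0 ?ltW.
pose eta := gam / 4.
have eta0 : 0 < eta by rewrite divr_gt0.
have eta1 : eta <= 1 by rewrite /eta; lra.
pose rho := expR (- (eta ^+ 2 / 8)).
(* Length of the remainder from which the union bound in [Stilde_ge] drops below one half. *)
have [m Hm] : exists m, K%:R * rho ^+ m <= 1 / 2.
  have rho0 : 0 < rho by exact: expR_gt0.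
  have rho1 : rho < 1 by rewrite -expR0 ltr_expR oppr_lt0 divr_gt0 ?exprn_gt0.
  have : (rho ^+ n @[n --> \oo] --> (0 : R)) by apply: cvg_expr; rewrite gtr0_norm.
  move=> /cvgrPdist_le /(_ (1 / 2 / K%:R)).
  have pos : 0 < 1 / 2 / K%:R :> R by rewrite !divr_gt0.
  move=> /(_ pos) [m _ /(_ m (leqnn m))] /=.
  rewrite sub0r normrN gtr0_norm ?exprn_gt0 // ler_pdivlMr // mulrC => h.
  by exists m.
apply: (@expected_stop_cvg 2 _ (2 * K.+1%:R * K%:R) (l + mu)
  (Num.min (Num.min eta ((1 - p l0) / 2)) (p l1 / 2))) => //.
- exact: KL_bern_gt0.
- by rewrite !mulr_gt0.
- by rewrite addr_ge0 // ltW.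
- by rewrite !lt_min eta0 !divr_gt0 // subr_gt0.
move=> e e0; rewrite !le_min => /andP[/andP[e1 e3] e2].
(* On a typical sample the remainder makes up at least [(1 - p l0) / 2] of the letters, hence has
   length at least [m]. *)
exists (Num.trunc (2 * m%:R / (1 - p l0))).+1 => s Ns ts.
have s0 : (0 < size s)%N by apply: leq_ltn_trans Ns.
have e1' : e <= (p l0 - p l1) / 4 by rewrite (le_trans e1) // ler_pdivrMr // mulrVK ?unitfE.
have [h0 h1 _] := typical_top e s s0 ts e1' e2.
set ns := sorted_counts s in h0 h1 *.
have ns0 : (0 < size ns)%N by exact: ltnW.
have /andP[h4 h5] := typical_counts e s l0 ts.
set n : R := (size s)%:R in h4 h5 *; have n0 : 0 < n by rewrite ltr0n.
have NE : (nbar 2 ns)%:R = n - (nth 0%N ns 0)%:R :> R.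
  by rewrite nbar2E // sumn_sorted_counts natrB // h0 count_size.
set N := nbar 2 ns in NE *; rewrite h0 in NE.
set a : R := (count_mem l0 s)%:R in h4 h5 NE *.
have Nm : (m <= N)%N.
  rewrite -(ler_nat R) NE; apply: (@le_trans _ _ ((1 - p l0) / 2 * n)).
    have : 2 * m%:R / (1 - p l0) <= n.
      by apply/ltW/(lt_le_trans (truncnS_gt _)); rewrite ler_nat.
    rewrite ler_pdivrMr ?subr_gt0 //; lra.
  have : e * n <= (1 - p l0) / 2 * n by rewrite ler_wpM2r // ltW.
  lra.
have Nle : N%:R <= (1 - p l0 + e) * n by rewrite NE; lra.
have N0 : 0 <= N%:R :> R by [].
(* The margin [gam] pays for [eta] and twice for [e], each at most [gam / 4]. *)
have box (u : R) : 0 <= u -> u <= 1 -> u * (1 - p l0) <= p l0 - gam ->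
    (u + eta) * N%:R <= a.
  move=> u0 u1 ug; apply: le_trans h4.
  apply: (@le_trans _ _ ((u + eta) * ((1 - p l0 + e) * n))).
    by rewrite ler_wpM2l // addr_ge0 // ltW.
  rewrite mulrA ler_wpM2r ?(ltW n0) //.
  have ue : u * e <= e by rewrite ler_piMl // ltW.
  have ee : eta * (1 - p l0 + e) <= eta.
    rewrite ler_piMr ?(ltW eta0) //; rewrite /eta in e1; lra.
  rewrite /eta in e1 ee *; lra.
have sum2 (j b : 'I_K) : j != b -> p j + p b <= 1.
  move=> jb; rewrite -p_sum (bigD1 j) //= lerD2l (bigD1 b) 1?eq_sym //= lerDl sumr_ge0 // => i _.
  exact: ltW.
have ratio0 (j b : 'I_K) : 0 <= p j / (1 - p b).
  by rewrite divr_ge0 ?subr_ge0 ?(ltW (p_gt0 _)) ?(ltW (p_lt1' _)).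
have ratio1 (j b : 'I_K) : j != b -> p j / (1 - p b) <= 1.
  by move=> /sum2 jb; rewrite ler_pdivrMr ?subr_gt0 // mul1r; lra.
pose y := (p l1 / p l0) ^+ nth 0%N ns 0 * ((1 - p l1) / (1 - p l0)) ^+ N.
have y0 : 0 < y by rewrite mulr_gt0 // exprn_gt0 // divr_gt0 // subr_gt0.
have /andP[err1 err2] : y / (y + 2 * K.+1%:R * K%:R) <= 1 - agg_posterior K 2 p ns
    <= 2 * K.+1%:R * K%:R * y.
  apply: (@agg_error_two _ _ _ _ l0 l1 _ _ _ _ _ _ eta) => //.
  - move=> j jl; rewrite h0; apply: box => //; first exact: ratio1.
    rewrite divfK; last by rewrite gt_eqF // subr_gt0.
    by have := p_le1 j jl; lra.
  - move=> j jl; rewrite h0; apply: box => //; first exact: ratio1.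
    have pj0 : p j <= p l0.
      by case: (eqVneq j l0) => [->//|/p_le1 h]; apply: le_trans h (ltW _).
    rewrite mulrAC ler_pdivrMr ?subr_gt0 //.
    have : p j * (1 - p l0) <= p l0 * (1 - p l0) by rewrite ler_wpM2r // subr_ge0 ltW.
    have : 0 <= p l0 * (p l1 * (p l0 - p l1)) by rewrite !mulr_ge0 ?subr_ge0 ?ltW.
    rewrite /gam; lra.
  - apply: le_trans Hm; rewrite ler_wpM2l ?(ltW K0) //; apply: ler_wiXn2l => //.
    by rewrite -[leRHS]expR0 ler_expR oppr_le0 divr_ge0 ?exprn_ge0 ?(ltW eta0).
  - rewrite h0 -/a NE.
    suff : n * p l1 <= a by lra.
    apply: le_trans h4; rewrite mulrC ler_wpM2r ?(ltW n0) //; lra.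
  - exact: total_weight_gt0.
exists y; split => //.
have yl : ln y = - l * a + mu * N%:R.
  rewrite /y [LHS]lnM ?posrE ?exprn_gt0 ?divr_gt0 ?subr_gt0 // !lnXn ?divr_gt0 ?subr_gt0 //.
  by rewrite ln_ratioN h0 -[X in X + _ = _]mulr_natr -[X in _ + X = _]mulr_natr.
have KLE : KL_bern (p l0) (p l1) = p l0 * l - (1 - p l0) * mu.
  by rewrite /KL_bern /mu -mulrN -lnV ?posrE ?divr_gt0 ?subr_gt0 // invf_div.
rewrite yl NE KLE.
(* Only the top count fluctuates, with total coefficient [l + mu]. *)
have -> : - l * a + mu * (n - a) + n * (p l0 * l - (1 - p l0) * mu) =
    (l + mu) * (p l0 * n - a) by ring.
rewrite normrM -mulrA gtr0_norm ?addr_gt0 // ler_wpM2l ?addr_ge0 ?(ltW lgt) ?(ltW mu0) //.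
rewrite ler_norml; apply/andP; split; lra.
Qed.

End Rates.

Theorem theorem1 (R : realType) (K : nat) (p : nat -> R)
  (hK : (2 <= K)%N)
  (hpos : forall i : nat, (i < K)%N -> 0 < p i)
  (h12 : p 1%N < p 0%N)
  (hmono : forall i j : nat, (1 <= i)%N -> (i <= j)%N -> (j < K)%N -> p j <= p i)
  (hsum : \sum_(i < K) p i = 1) :
  ((fun delta : R => (expected_stop K 2 p delta * ((ln delta^-1)^-1)%:E)%E)
      @ 0^'+ --> ((KL_bern (p 0%N) (p 1%N))^-1)%:E)
  /\
  (forall L : nat, (3 <= L)%N -> (L <= K)%N ->
    (fun delta : R => (expected_stop K L p delta * ((ln delta^-1)^-1)%:E)%E)
      @ 0^'+ --> (((p 0%N - p 1%N) * ln (p 0%N / p 1%N))^-1)%:E).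
Proof.
pose l0 : 'I_K := Ordinal (ltnW hK); pose l1 : 'I_K := Ordinal hK.
have p_gt0 (k : 'I_K) : 0 < p k by exact: hpos.
have p_le1 (k : 'I_K) : k != l0 -> p k <= p l1.
  by move=> kl; apply: hmono => //=; rewrite lt0n.
split; first exact: (expected_stop_two_cvg l0 l1 erefl erefl p_gt0 p_le1 h12 hsum).
exact: (expected_stop_many_cvg l0 l1 erefl erefl p_gt0 p_le1 h12 hsum).
Qed.
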